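(* Fix $n,d,k\in\mathbb{N}$, $L\ge 2$, and $1\ge\delta>0$. There exist $b\in\mathbb{N}$ and an estimator $V_n\in\mathcal{H}_{d,b}^k$ such that $$\sup_{p\in Q}P\left(\|V_n-p\|_1>\frac{21dk^{1/3}L^{\frac{d+3}{12}}}{n^{\frac13}}\sqrt{\log(3Ldkn)}+7\sqrt{\frac{\log(\frac{3}{\delta})}{2n}}\right)<\delta,$$ where $Q$ is the set of densities of the form $\sum_{i=1}^k w_i\prod_{j=1}^d p_{i,j}$ with $p_{i,j}\in\operatorname{Lip}_L$ and $w\in\Delta_k$, and $V_n$ is a function of $X_1,\ldots,X_n\overset{iid}{\sim}p$.
   Context: $\mathbb{N}$ denotes the positive integers, $[b]=\{1,\ldots,b\}$, and $\log$ is the natural logarithm. Densities are considered on the unit cube $[0,1)^d$ (with respect to Lebesgue measure; endpoints are immaterial); $\|\cdot\|_1$ is the $L^1$ norm. $\operatorname{Lip}_L$ is the set of $L$-Lipschitz probability density functions on $[0,1]$. $\Delta_k$ is the set of vectors in $\mathbb{R}^k$ with nonnegative entries summing to one. For $i\in[b]$, let $h_{1,b,i}(x)=b\,\mathbf{1}\left(\frac{i-1}{b}\le x<\frac{i}{b}\right)$, and let $\mathcal{H}_{1,b}$ be the convex hull of $\{h_{1,b,i}: i\in[b]\}$. For univariate functions, $\prod_{j=1}^d p_j$ denotes $(x_1,\ldots,x_d)\mapsto\prod_{j=1}^d p_j(x_j)$. The set of multi-view histograms is $$\mathcal{H}_{d,b}^k=\left\{\sum_{i=1}^k w_i\prod_{j=1}^d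 p_{i,j}\;:\; w\in\Delta_k,\ p_{i,j}\in\mathcal{H}_{1,b}\right\}.$$ An estimator $V_n\in\mathcal{H}_{d,b}^k$ is a function of the sample (not depending on $p$) with values in $\mathcal{H}_{d,b}^k$. *)

(* Defs.v *)
From HB Require Import structures.
From mathcomp Require Import all_boot all_order all_algebra.
From mathcomp Require Import all_classical all_reals all_analysis.

Set Implicit Arguments.
Unset Strict Implicit.
Unset Printing Implicit Defensive.

Import Order.TTheory GRing.Theory Num.Theory.
Import numFieldNormedType.Exports.

Local Open Scope classical_set_scope.
Local Open Scope ring_scope.

Section tuple_measure.
Context {disp : measure_display} {T : measurableType disp} {R : realType}.

Definition tuple_cons (n : nat) (z : T * n.-tuple T) : n.+1.-tuple T :=
  [tuple of z.1 :: z.2].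

(* The n-fold product mu x ... x mu.  It is defined for an arbitrary set
   function mu; for a sigma-finite measure mu it is the product measure, by
   [tuple_measure_sigma_finite] and [tuple_measure_box]. *)
Fixpoint tuple_measure (mu : set T -> \bar R) (n : nat) :
    set (n.-tuple T) -> \bar R :=
  match n with
  | 0 => dirac [tuple]
  | m.+1 => pushforward (product_measure1 mu (@tuple_measure mu m))
                        (@tuple_cons m)
  end.

End tuple_measure.
Arguments tuple_measure {disp T R} mu n _.

Section tuple_measure_theory.
Local Open Scope ereal_scope.
Context {disp : measure_display} {T : measurableType disp} {R : realType}.

Lemma measurable_tuple_cons (n : nat) :
  measurable_fun [set: T * n.-tuple T] (@tuple_cons disp T n).
Proof. exact: measurable_cons. Qed.

Lemma tuple_measure_sigma_finite
    (mu : {sigma_finite_measure set T -> \bar R}) (n : nat) :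
  exists m : {sigma_finite_measure set (n.-tuple T) -> \bar R},
    tuple_measure mu n = m.
Proof.
elim: n => [|n [m IHm]] /=.
  by exists [the {sigma_finite_measure set (0.-tuple T) -> \bar R} of
             dirac [tuple]].
rewrite IHm.
have mc := @measurable_tuple_cons n.
pose nuM : {measure set (n.+1.-tuple T) -> \bar R} :=
  measure_function_pushforward__canonical__measure_function_Measure
    (product_measure1 mu m) mc.
have sf : sigma_finite setT nuM.
  have [F TF Foo] : sigma_finite setT (product_measure1 mu m).
    have /sigma_finiteP[F [TF ndF Foo]] := sigma_finiteT mu.
    have /sigma_finiteP[G [TG ndG Goo]] := sigma_finiteT m.
    exists (fun i => F i `*` G i).
      rewrite -setXTT TF TG predeqE => -[x y]; split.
        move=> [/= [i _ Fix] [j _ Gjy]]; exists (maxn i j) => //; split.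
        - by move: x Fix; exact/subsetPset/ndF/leq_maxl.
        - by move: y Gjy; exact/subsetPset/ndG/leq_maxr.
      by move=> [i _ []/= ? ?]; split; exists i.
    move=> i; have [? ?] := Foo i; have [? ?] := Goo i.
    split; first exact: measurableX.
    by rewrite product_measure1E// lte_mul_pinfty// ge0_fin_numE.
  pose g (t : n.+1.-tuple T) := (thead t, [tuple of behead t]).
  have mg : measurable_fun setT g.
    apply/measurable_fun_pairP; split.
      exact: measurable_tnth.
    exact: measurable_behead.
  have gK z : g (tuple_cons z) = z.
    case: z => x t; congr (_, _); apply: val_inj => //=.
  exists (fun i => g @^-1` F i).
    by rewrite -preimage_bigcup -TF preimage_setT.
  move=> i; have [mF Fi] := Foo i; split.
    by rewrite -[X in measurable X]setTI; exact: mg.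
  rewrite /nuM /= /pushforward.
  suff -> : @tuple_cons _ T n @^-1` (g @^-1` F i) = F i by [].
  by apply/seteqP; split => z /=; rewrite gK.
pose nuS : {sigma_finite_measure set (n.+1.-tuple T) -> \bar R} :=
  HB.pack (Measure.sort nuM) (Measure.class nuM)
    (Measure_isSigmaFinite.Build _ _ _ nuM sf).
by exists nuS.
Qed.

Section instances.
Variables (mu : {sigma_finite_measure set T -> \bar R}) (n : nat).

Let tuple_measure0 : tuple_measure mu n set0 = 0.
Proof. by have [m ->] := tuple_measure_sigma_finite mu n. Qed.

Let tuple_measure_ge0 A : 0 <= tuple_measure mu n A.
Proof. by have [m ->] := tuple_measure_sigma_finite mu n. Qed.

Let tuple_measure_sigma_additive : semi_sigma_additive (tuple_measure mu n).
Proof.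
have [m ->] := tuple_measure_sigma_finite mu n.
exact: measure_semi_sigma_additive.
Qed.

HB.instance Definition _ := isMeasure.Build _ _ _ (tuple_measure mu n)
  tuple_measure0 tuple_measure_ge0 tuple_measure_sigma_additive.

Let tuple_measure_sigma_finiteT : sigma_finite setT (tuple_measure mu n).
Proof.
have [m ->] := tuple_measure_sigma_finite mu n.
exact: sigma_finiteT.
Qed.

HB.instance Definition _ := Measure_isSigmaFinite.Build _ _ _
  (tuple_measure mu n) tuple_measure_sigma_finiteT.

End instances.

Lemma tuple_measure_box (mu : {sigma_finite_measure set T -> \bar R})
    (n : nat) (A : 'I_n -> set T) : (forall i, measurable (A i)) ->
  tuple_measure mu n [set t | forall i, A i (tnth t i)] =
  \prod_(i < n) mu (A i).
Proof.
elim: n A => [|n IHn] A mA.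
  by rewrite big_ord0 /= diracE mem_set//= => -[].
have [m tm] := tuple_measure_sigma_finite mu n.
rewrite big_ord_recl /= /pushforward tm.
rewrite (_ : _ @^-1` _ = A ord0 `*`
    [set t | forall i, A (lift ord0 i) (tnth t i)]); last first.
  apply/seteqP; split => -[x t] /=.
    move=> H; split; first by have := H ord0.
    by move=> i; have := H (lift ord0 i); rewrite tnthS.
  move=> [Ax At] i; have [j ->|->//] := unliftP ord0 i.
  by rewrite tnthS; exact: At.
rewrite product_measure1E//.
  by rewrite -IHn// tm.
rewrite [X in measurable X](_ : _ =
  \bigcap_(i in [set: 'I_n]) [set t | A (lift ord0 i) (tnth t i)]); last first.
  by apply/seteqP; split => t /= H i; [move=> _|]; exact: H.
apply: fin_bigcap_measurable => // i _.
by rewrite -[X in measurable X]setTI; exact: measurable_tnth.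
Qed.

End tuple_measure_theory.

Unset Implicit Arguments.

Section multiview.
Context {R : realType}.

(* The points of [0,1)^d inside R^d.  Functions of d real variables are total;
   only their values on the cube matter in integrals and norms below. *)
Definition cube (d : nat) : set (d.-tuple (measurableTypeR R)) :=
  [set x | forall j, tnth x j \in `[0, 1[].

Definition lebesgue_tuple (d : nat) :
    set (d.-tuple (measurableTypeR R)) -> \bar R :=
  tuple_measure lebesgue_measure d.

HB.instance Definition _ (d : nat) :=
  SigmaFiniteMeasure.copy (lebesgue_tuple d)
    (tuple_measure (@lebesgue_measure R) d).

Definition L1norm {d : nat} (f : d.-tuple (measurableTypeR R) -> R) : \bar R :=
  'N[lebesgue_tuple d]_1[(EFin \o f) \_ (cube d)].

Definition density_law {d : nat} (p : d.-tuple (measurableTypeR R) -> R) :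
    set (d.-tuple (measurableTypeR R)) -> \bar R :=
  fun A => (\int[lebesgue_tuple d]_(x in A `&` cube d) (p x)%:E)%E.

(* The joint law of X_1, ..., X_n iid with density p. *)
Definition sample_law {d : nat} (p : d.-tuple (measurableTypeR R) -> R)
    (n : nat) : set (n.-tuple (d.-tuple (measurableTypeR R))) -> \bar R :=
  tuple_measure (density_law p) n.

Definition simplex (k : nat) : set ('I_k -> R) :=
  [set w | (forall i, 0 <= w i) /\ \sum_(i < k) w i = 1].

Definition Lip (L : R) : set (R -> R) :=
  [set p : R -> R | [/\ L.-lipschitz_(`[0 : R, 1]%classic) p,
              forall x, x \in `[0, 1] -> 0 <= p x &
              (\int[lebesgue_measure]_(x in `[0%R, 1%R]) (p x)%:E = 1)%E]].

(* Indices start at 0, so the i-th bin is [i/b, (i+1)/b). *)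
Definition hist1 (b : nat) (i : 'I_b) : R -> R :=
  fun x => b%:R * \1_(`[i%:R / b%:R, i.+1%:R / b%:R[%classic) x.

Definition Hist1 (b : nat) : set (R -> R) :=
  smallest (@convex_set R (R -> R)) (range (hist1 b)).

Definition multiview (d k : nat) (F : set (R -> R)) :
    set (d.-tuple (measurableTypeR R) -> R) :=
  [set f | exists (w : 'I_k -> R) (p : 'I_k -> 'I_d -> R -> R),
    [/\ simplex k w, forall i j, F (p i j) &
        f = fun x => \sum_(i < k) w i * \prod_(j < d) p i j (tnth x j)]].

Definition Hist (d b k : nat) := multiview d k (Hist1 b).

(* A measurable function of the sample with values in Hist d b k;
   measurability makes [set s | t < L1norm (V s - p)] an event. *)
Definition estimator {n d : nat} (b k : nat)
    (V : n.-tuple (d.-tuple (measurableTypeR R)) ->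
         d.-tuple (measurableTypeR R) -> R) : Prop :=
  (forall s, Hist d b k (V s)) /\
  measurable_fun setT
    (fun z : n.-tuple (d.-tuple (measurableTypeR R)) *
             d.-tuple (measurableTypeR R) => V z.1 z.2).

End multiview.

(* Main.v *)
Require Import Defs.
From HB Require Import structures.
From mathcomp Require Import all_boot all_order all_algebra.
From mathcomp Require Import all_classical all_reals all_analysis.
From mathcomp Require Import measurable_realfun ring lra.

Set Implicit Arguments.
Unset Strict Implicit.
Unset Printing Implicit Defensive.

Import Order.TTheory GRing.Theory Num.Theory.
Import numFieldNormedType.Exports.
Local Open Scope classical_set_scope.
Local Open Scope ring_scope.

(** The estimator selects, by minimum distance, one member of a finite net of
    multi-view histograms; its error is a bias plus a deviation term.

    Bias.  A Lipschitz density is rounded bin by bin to multiples of [1 / b] and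
    renormalised, at an L1 cost of [3 L / b] ([Lip_hist_approx]).  Passing to
    products adds the errors of the factors ([l1dist_prod_fun]), passing to
    mixtures averages them, and rounding the weights costs [2 / b], so the net
    comes within [3 d L / b + 2 / b] of every density of the class
    ([net_approx]).  Since all roundings are described by bounded integers, the
    net has a finite number [M] of members; for the [b] chosen below, [ln M] is
    of order [k d b ln (3 L d k n)] ([net_card_le]).

    Deviation.  The L1 distance of two members [f_i], [f_j] is twice the
    difference of the masses which they give to the set where [f_j < f_i]
    ([scheffe]).  A member whose masses on these [M ^ 2] sets fit the empirical
    frequencies best is therefore almost as close to the truth as any other: its
    error is at most three times the smallest possible one plus [4 e], where [e]
    bounds the deviations of the frequencies ([mindist_selector_l1dist]).  The
    exponential Markov inequality and a union bound show that [e] is exceeded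
    with probability at most [2 M ^ 2 exp (- 3/4 n e ^ 2)]
    ([mindist_selector_risk]).

    Balance.  Put [rho = (k L / n) ^ (1/3)], [Y = d rho sqrt (ln (3 L d k n))]
    and [a = sqrt (ln (3 / delta) / (2 n))].  With about [2 L / rho] bins, three
    times the bias is at most [6 Y] and [ln M] is at most [675/128 n Y ^ 2]; so
    [e = 7/4 a + 15/4 Y] has failure probability at most [2/3 delta], while
    [6 Y + 4 e = 21 Y + 7 a] is below the claimed bound because
    [L ^ (1/3) <= L ^ ((d + 3) / 12)].  This uses that [rho] is small; when
    [21 rho >= 2] the claimed bound is at least 2, which no L1 distance of
    densities exceeds. *)

(** * Integrals of products over tuples *)

Section tuple_integral.
Local Open Scope ereal_scope.
Context {disp : measure_display} {T : measurableType disp} {R : realType}.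

Lemma measurable_prod_tnth (n : nat) (f : 'I_n -> T -> R) :
  (forall i, measurable_fun setT (f i)) ->
  measurable_fun [set: n.-tuple T] (fun t => (\prod_(i < n) f i (tnth t i))%R).
Proof.
move=> mf; apply: (@measurable_prod _ _ _ setT _ (index_enum 'I_n)
  (fun i t => f i (tnth t i))) => i _.
exact: measurableT_comp (mf i) (measurable_tnth i).
Qed.

(** Tonelli's theorem, one coordinate at a time.  It is used twice: for the
    moment generating function of an iid sample and for product densities. *)
Lemma ge0_integral_tuple_prod (mu : {sigma_finite_measure set T -> \bar R})
    (n : nat) (f : 'I_n -> T -> R) :
  (forall i, measurable_fun setT (f i)) -> (forall i x, (0 <= f i x)%R) ->
  \int[tuple_measure mu n]_t (\prod_(i < n) f i (tnth t i))%:E =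
  \prod_(i < n) \int[mu]_x (f i x)%:E.
Proof.
elim: n f => [|n IHn] f mf f0.
  rewrite big_ord0 /=.
  under eq_integral do rewrite big_ord0.
  by rewrite integral_dirac// diracT mul1e.
have [m tm] := tuple_measure_sigma_finite mu n.
rewrite big_ord_recl /= tm.
have ge0prod k (g : 'I_k -> T -> R) (t : k.-tuple T) :
    (forall i x, (0 <= g i x)%R) -> (0 <= \prod_(i < k) g i (tnth t i))%R.
  by move=> g0; apply: prodr_ge0.
rewrite ge0_integral_pushforward//=; last 3 first.
- exact: measurable_tuple_cons.
- by apply/measurable_EFinP; exact: measurable_prod_tnth.
- by move=> t _; rewrite lee_fin ge0prod.
rewrite preimage_setT fubini_tonelli1//=; last 2 first.
- apply/measurable_EFinP.
  exact: (@measurableT_comp _ _ _ _ _ _ _ _ _ (measurable_prod_tnth mf)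
     (@measurable_tuple_cons _ T n)).
- by move=> t; rewrite lee_fin ge0prod.
rewrite /fubini_F /=.
transitivity (\int[mu]_x ((f ord0 x)%:E *
    \prod_(i < n) \int[mu]_y (f (lift ord0 i) y)%:E)).
  apply: eq_integral => x _.
  under eq_integral do rewrite big_ord_recl EFinM tnth0.
  rewrite /= ge0_integralZl_EFin//; last 2 first.
  - by move=> t _; rewrite lee_fin; apply: prodr_ge0.
  - apply/measurable_EFinP.
    rewrite (_ : (fun t => _) = (fun t : n.-tuple T =>
        (\prod_(i < n) f (lift ord0 i) (tnth t i))%R)).
      exact: (@measurable_prod_tnth n (fun i => f (lift ord0 i))).
    by apply/funext => t; apply: eq_bigr => i _; rewrite tnthS.
  congr (_ * _).
  rewrite -IHn// tm.
  apply: eq_integral => t _; congr EFin.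
  by apply: eq_bigr => i _; rewrite tnthS.
rewrite ge0_integralZr//.
- exact/measurable_EFinP.
- by move=> x _; rewrite lee_fin.
- by apply: prode_ge0 => i _; apply: integral_ge0 => x _; rewrite lee_fin.
Qed.
End tuple_integral.

(** * Exponential concentration of empirical frequencies *)

Section exp_bounds.
Context {R : realType}.
Implicit Types u p t : R.

Lemma expR1_le3 : expR (1 : R) <= 3.
Proof.
have h : expR (6^-1 : R) <= 6 / 5.
  have h6 : 5 / 6 <= expR (- 6^-1 : R).
    by apply: le_trans (expR_ge1Dx _); lra.
  rewrite -[6^-1]opprK expRN (_ : 6 / 5 = (5 / 6)^-1); last by field.
  by rewrite lef_pV2 ?posrE ?expR_gt0//; lra.
rewrite (_ : 1 = 6%:R * 6^-1 :> R); last by lra.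
rewrite expRM_natl (le_trans (lerXn2r 6 _ _ h)) ?nnegrE ?expR_ge0//; lra.
Qed.

(** The chord of the convex function [exp] over [[0, 1]] has slope at most 2. *)
Lemma expR_le1D2x u : 0 <= u <= 1 -> expR u <= 1 + 2 * u.
Proof.
move=> /andP[u0 u1]; have := convex_expR (Itv01 u0 u1) 1 0.
rewrite !convRE /= expR0 mulr1 mulr0 addr0 mulr1 => /le_trans; apply.
by rewrite /unstable.onem; have := expR1_le3; nra.
Qed.

(** [g x = exp x - x - x ^ 2] is maximal at 0 on [[-1, 1]]: its derivative
    [exp x - (1 + 2 x)] is nonpositive on the right of 0 by convexity, and
    nonnegative on the left because [1 + 2 x <= 1 + x <= exp x] there. *)
Lemma expR_le1DxDxx u : -1 <= u <= 1 -> expR u <= 1 + u + u ^+ 2.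
Proof.
move=> u1.
pose g (x : R) : R := expR x - x - x ^+ 2.
pose dg (x : R) : R := expR x - 1 - 2 * x.
have gd (x : R) : is_derive x 1 g (dg x).
  apply: is_derive_eq.
  by rewrite /dg /GRing.scale /=; ring.
have cg a b : {within `[a, b], continuous g}.
  apply: continuous_subspaceT => x.
  by apply/differentiable_continuous/derivable1_diffP; have [] := gd x.
have g0 : g 0 = 1 by rewrite /g expR0; ring.
suff : g u <= g 0 by rewrite g0 /g; lra.
have [u0|u0] := leP 0 u.
- have [c] := MVT_segment u0 (fun x _ => gd x) (cg _ _).
  rewrite in_itv/= => /andP[c0 cu] gE.
  have : expR c <= 1 + 2 * c by apply: expR_le1D2x; lra.
  by move: gE; rewrite /dg; nra.
- have [c] := MVT_segment (ltW u0) (fun x _ => gd x) (cg _ _).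
  rewrite in_itv/= => /andP[c0 cu] gE.
  have := expR_ge1Dx c.
  by move: gE; rewrite /dg; nra.
Qed.

(** Hoeffding's lemma for a centred Bernoulli variable, with [1/4] in place of
    the optimal [1/8]: the linear terms of [exp u <= 1 + u + u ^ 2] cancel and
    the quadratic ones add up to the variance [p (1 - p) <= 1/4]. *)
Lemma bernoulli_mgf_le p t : 0 <= p <= 1 -> -1 <= t <= 1 ->
  p * expR (t * (1 - p)) + (1 - p) * expR (t * (0 - p)) <= expR (t ^+ 2 / 4).
Proof.
move=> p01 t1.
have h1 : expR (t * (1 - p)) <= 1 + t * (1 - p) + (t * (1 - p)) ^+ 2.
  by apply: expR_le1DxDxx; nra.
have h2 : expR (t * (0 - p)) <= 1 + t * (0 - p) + (t * (0 - p)) ^+ 2.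
  by apply: expR_le1DxDxx; nra.
apply: le_trans (expR_ge1Dx _).
apply: (@le_trans _ _ (1 + t ^+ 2 * (p * (1 - p)))).
  have -> : 1 + t ^+ 2 * (p * (1 - p)) =
    p * (1 + t * (1 - p) + (t * (1 - p)) ^+ 2) +
    (1 - p) * (1 + t * (0 - p) + (t * (0 - p)) ^+ 2) by ring.
  by apply: lerD; apply: ler_wpM2l => //; lra.
rewrite lerD2l ler_wpM2l ?sqr_ge0//.
have := sqr_ge0 (2 * p - 1); lra.
Qed.
End exp_bounds.

Section empirical_tail.
Context {disp : measure_display} {T : measurableType disp} {R : realType}.
Variable P : probability T R.
Local Open Scope ereal_scope.

Lemma integral_expR_indic (A : set T) (t c : R) : measurable A ->
  \int[P]_x (expR (t * (\1_A x - c)))%:E =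
  (fine (P A) * expR (t * (1 - c)) + (1 - fine (P A)) * expR (t * (0 - c)))%:E.
Proof.
move=> mA.
have mI B : measurable B -> measurable_fun setT (EFin \o (\1_B : T -> R)).
  by move=> mB; apply/measurable_EFinP; exact: measurable_indic.
under eq_integral => x _.
  rewrite (_ : expR (t * (\1_A x - c)) = \1_A x * expR (t * (1 - c)) +
     \1_(~` A) x * expR (t * (0 - c)))%R; last first.
    rewrite !indicE in_setC; by case: (x \in A) => /=; ring.
  rewrite EFinD !EFinM; over.
have mAC := measurableC mA.
rewrite ge0_integralD//; last 2 first.
- by apply: emeasurable_funM => //; exact: mI.
- by apply: emeasurable_funM => //; exact: mI.
rewrite !ge0_integralZr//; try exact: mI; try by rewrite lee_fin expR_ge0.
rewrite !integral_indic// !setIT.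
rewrite -[LHS]/(P A * _ + P (~` A) * _) probability_setC//.
have PA : P A \is a fin_num by exact: fin_num_measure.
by rewrite EFinD !EFinM EFinB fineK.
Qed.

(** Chernoff's method with parameter [t = eps]: this choice keeps the exponents
    in [[-1, 1]], where [bernoulli_mgf_le] applies, and leaves
    [- eps ^ 2 + eps ^ 2 / 4 = - 3/4 eps ^ 2] per observation. *)
Lemma empirical_upper_tail (n : nat) (A : set T) (eps : R) :
  measurable A -> (0 < eps <= 1)%R ->
  tuple_measure P n [set s | (n%:R * (fine (P A) + eps) <=
     \sum_(i < n) \1_A (tnth s i))%R] <=
  (expR (- (3 / 4 * n%:R * eps ^+ 2)))%:E.
Proof.
move=> mA e01; set pA := fine (P A).
pose g (x : T) : R := expR (eps * (\1_A x - pA)).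
have mg : measurable_fun setT g.
  apply: measurableT_comp => //; apply: measurable_funM => //.
  by apply: measurable_funB => //; exact: measurable_indic.
pose G (s : n.-tuple T) : R := (\prod_(i < n) g (tnth s i))%R.
have mG : measurable_fun setT G.
  by exact: (@measurable_prod_tnth _ _ _ n (fun=> g)).
have GE s : G s = expR (eps * (\sum_(i < n) \1_A (tnth s i) - n%:R * pA)).
  rewrite /G -expR_sum -mulr_sumr; congr (expR (_ * _)).
  by rewrite sumrB sumr_const card_ord mulr_natl.
have G0 s : (0 < G s)%R by rewrite GE expR_gt0.
have intG : \int[tuple_measure P n]_s (G s)%:E <=
    (expR (n%:R * (eps ^+ 2 / 4)))%:E.
  rewrite (@ge0_integral_tuple_prod _ _ _ P n (fun=> g))//; last first.
    by move=> i x; exact: expR_ge0.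
  rewrite integral_expR_indic// -(big_morph EFin (@EFinM R) erefl) lee_fin.
  rewrite prodr_const card_ord.
  have p01 : (0 <= pA <= 1)%R.
    have PA : P A \is a fin_num by exact: fin_num_measure.
    by rewrite -!lee_fin fineK// measure_ge0 probability_le1.
  have e11 : (-1 <= eps <= 1)%R by lra.
  have [p0 p1] := andP p01.
  rewrite expRM_natl lerXn2r ?nnegrE ?expR_ge0//.
    by rewrite addr_ge0// mulr_ge0 ?expR_ge0// subr_ge0.
  exact: bernoulli_mgf_le.
have := @le_integral_comp_abse _ _ _ (tuple_measure P n) setT measurableT
  (EFin \o G) (expR (n%:R * eps ^+ 2)) id (@measurable_id _ _ _)
  (fun r h => h) (fun x y _ _ h => h).
move=> /(_ _ (expR_gt0 _)).
have -> : \int[tuple_measure P n]_x `|(EFin \o G) x| =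
    \int[tuple_measure P n]_x (G x)%:E.
  by apply: eq_integral => s _ /=; rewrite ger0_norm ?ltW.
rewrite setTI (_ : [set x | _] = [set s | (n%:R * (pA + eps) <=
     \sum_(i < n) \1_A (tnth s i))%R]); last first.
  have [e0 _] := andP e01.
  apply/seteqP; split => s /=;
    rewrite lee_fin ger0_norm ?(ltW (G0 s))// GE ler_expR;
    by rewrite expr2 mulrCA ler_pM2l// lerBrDl -mulrDr.
have mGE : measurable_fun setT (EFin \o G) by exact/measurable_EFinP.
move=> /(_ mGE)/le_trans => /(_ _ intG).
rewrite -lee_pdivlMl ?expR_gt0// => /le_trans; apply.
rewrite -expRN -EFinM -expRD lee_fin ler_expR; lra.
Qed.

End empirical_tail.

(** * Densities and their L1 distance *)

Definition pdf {disp : measure_display} {T : measurableType disp}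
    {R : realType} (mu : set T -> \bar R) (f : T -> R) :=
  [/\ measurable_fun setT f, forall x, 0 <= f x &
      (\int[mu]_x (f x)%:E = 1)%E].

Section l1_distance.
Context {disp : measure_display} {T : measurableType disp} {R : realType}.
Variable mu : {measure set T -> \bar R}.
Implicit Types (f g h : T -> R) (A : set T).

Definition l1dist f g : R := \int[mu]_x `|f x - g x|.

Lemma pdf_integrable f : pdf mu f -> mu.-integrable setT (EFin \o f).
Proof.
move=> [mf f0 f1]; apply/integrableP; split; first exact/measurable_EFinP.
under eq_integral do rewrite /= ger0_norm ?f0//.
by rewrite f1 ltry.
Qed.

Lemma pdf_integrableS f A : measurable A -> pdf mu f ->
  mu.-integrable A (EFin \o f).
Proof. by move=> mA pf; apply: integrableS (pdf_integrable pf). Qed.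

Lemma pdf_Rintegral f : pdf mu f -> \int[mu]_x f x = 1.
Proof. by move=> [_ _ f1]; rewrite /Rintegral f1. Qed.

Lemma pdf_integrableB f g A : measurable A -> pdf mu f -> pdf mu g ->
  mu.-integrable A (EFin \o (fun x => f x - g x)).
Proof.
move=> mA pf pg.
exact: (integrableB mA (pdf_integrableS mA pf) (pdf_integrableS mA pg)).
Qed.

Lemma pdf_integrable_dist f g A : measurable A -> pdf mu f -> pdf mu g ->
  mu.-integrable A (EFin \o (fun x => `|f x - g x|)).
Proof.
move=> mA pf pg; apply: (integrable_norm (f := fun x => f x - g x)).
exact: pdf_integrableB.
Qed.

Lemma l1distE f g : pdf mu f -> pdf mu g ->
  (\int[mu]_x `|f x - g x|%:E = (l1dist f g)%:E)%E.
Proof.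
move=> pf pg; rewrite /l1dist /Rintegral fineK//.
by apply: integrable_fin_num => //; exact: pdf_integrable_dist.
Qed.

Lemma l1dist_setC f g A : measurable A -> pdf mu f -> pdf mu g ->
  l1dist f g =
  \int[mu]_(x in A) `|f x - g x| + \int[mu]_(x in ~` A) `|f x - g x|.
Proof.
move=> mA pf pg; rewrite -Rintegral_setU//.
- by rewrite setUv.
- exact: measurableC.
- by rewrite setUv; exact: pdf_integrable_dist.
- by apply/disj_setPCl.
Qed.

Lemma pdf_mass_setC f A : measurable A -> pdf mu f ->
  \int[mu]_(x in ~` A) f x = 1 - \int[mu]_(x in A) f x.
Proof.
move=> mA pf; rewrite -(pdf_Rintegral pf) -(setUv A) Rintegral_setU//.
- by rewrite addrAC subrr add0r.
- exact: measurableC.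
- by rewrite setUv; exact: pdf_integrable.
- by apply/disj_setPCl.
Qed.

(** The factor 2 comes from the equal total masses: [f - g] has opposite
    integrals over [A] and its complement, and each of them is bounded by the
    share of the L1 distance on that side. *)
Lemma mass_diff_le_l1dist f g A : measurable A -> pdf mu f -> pdf mu g ->
  2 * `|\int[mu]_(x in A) f x - \int[mu]_(x in A) g x| <= l1dist f g.
Proof.
move=> mA pf pg; have mAC := measurableC mA.
have half B : measurable B ->
    `|\int[mu]_(x in B) f x - \int[mu]_(x in B) g x| <=
    \int[mu]_(x in B) `|f x - g x|.
  move=> mB; rewrite -RintegralB//; [|exact: pdf_integrableS..].
  by apply: le_normr_Rintegral => //; exact: pdf_integrableB.
rewrite (l1dist_setC mA pf pg) mulr_natl mulr2n lerD ?half//.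
apply: le_trans (half _ mAC); rewrite !pdf_mass_setC//.
by rewrite -normrN le_eqVlt; apply/orP; left; apply/eqP; congr `|_|; ring.
Qed.

(** Scheffe's identity: on [A] the integrand is [f - g], off [A] it is [g - f],
    and both contribute the same amount since [f] and [g] have the same total
    mass.  Distances between candidate densities thereby become differences of
    probabilities of one event. *)
Lemma scheffe f g : pdf mu f -> pdf mu g ->
  l1dist f g = 2 * (\int[mu]_(x in [set x | g x < f x]) f x -
                    \int[mu]_(x in [set x | g x < f x]) g x).
Proof.
move=> pf pg; set A := [set x | _].
have mA : measurable A.
  have [mf _ _] := pf; have [mg _ _] := pg.
  rewrite -[A]setTI.
  have := measurable_fun_ltr mg mf measurableT
    (Logic.I : measurable [set true]).
  exact.
have mAC := measurableC mA.
rewrite (l1dist_setC mA pf pg).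
rewrite [X in X + _](@eq_Rintegral _ _ _ mu _ (fun x => f x - g x)); last first.
  by move=> x; rewrite inE => /= gf; rewrite gtr0_norm// subr_gt0.
rewrite [X in _ + X](@eq_Rintegral _ _ _ mu _ (fun x => g x - f x)); last first.
  move=> x; rewrite inE => /= /negP; rewrite -leNgt => fg.
  by rewrite distrC ger0_norm// subr_ge0.
rewrite !RintegralB//; [|exact: pdf_integrableS..].
rewrite !pdf_mass_setC//; ring.
Qed.

Lemma l1dist_triangle f g h : pdf mu f -> pdf mu g -> pdf mu h ->
  l1dist f h <= l1dist f g + l1dist g h.
Proof.
move=> pf pg ph; rewrite /l1dist -RintegralD//; [|exact: pdf_integrable_dist..].
apply: le_Rintegral => //; first exact: pdf_integrable_dist.
  exact: (integrableD measurableT (pdf_integrable_dist measurableT pf pg)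
                                  (pdf_integrable_dist measurableT pg ph)).
by move=> x _; exact: ler_distD.
Qed.

Lemma l1dist_le2 f g : pdf mu f -> pdf mu g -> l1dist f g <= 2.
Proof.
move=> pf pg; rewrite [leRHS](_ : _ = \int[mu]_x (f x + g x)); last first.
  by rewrite RintegralD ?pdf_Rintegral//; exact: pdf_integrable.
have [_ f0 _] := pf; have [_ g0 _] := pg.
apply: le_Rintegral => //; first exact: pdf_integrable_dist.
  exact: (integrableD measurableT (pdf_integrable pf) (pdf_integrable pg)).
by move=> x _; rewrite (le_trans (ler_normB _ _))// !ger0_norm.
Qed.

(** The set function [A |-> \int[mu]_(x in A) f x] coincides on all sets, also
    the non-measurable ones, with a genuine probability measure; the equality of
    functions allows replacing one by the other inside [tuple_measure]. *)
Lemma pdf_law f : pdf mu f ->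
  exists P : probability T R,
    (P : set T -> \bar R) = fun A => (\int[mu]_(x in A) (f x)%:E)%E.
Proof.
move=> [mf f0 f1].
pose m (A : set T) : \bar R := (\int[mu]_(x in A) (f x)%:E)%E.
have m0 : m set0 = 0%E by rewrite /m integral_set0.
have mge0 A : (0 <= m A)%E.
  by apply: integral_ge0 => x _; rewrite lee_fin.
have ms : semi_sigma_additive m.
  move=> F mF tF mUF; rewrite /m ge0_integral_bigcup//; last 2 first.
  - by apply/measurable_EFinP; exact: measurable_funS mf.
  - by move=> x _; rewrite lee_fin.
  by apply: is_cvg_ereal_nneg_natsum => n _; exact: mge0.
have m1 : m setT = 1%E by [].
pose M : {measure set T -> \bar R} :=
  HB.pack m (isMeasure.Build _ _ _ m m0 mge0 ms).
pose P : probability T R :=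
  HB.pack (Measure.sort M) (Measure.class M)
    (Measure_isProbability.Build _ _ _ M m1).
by exists P.
Qed.

End l1_distance.

(** * Minimum distance selection from a finite family *)

Section mindist.
Context {R : realType} {I K : finType}.
Variables (i0 : I) (Q : I -> K -> R).

Definition discrepancy (m : K -> R) (i : I) : R :=
  \big[Num.max/0]_(a : K) `|Q i a - m a|.

(** [Q i a] is the value which candidate [i] predicts for statistic [a], and [m]
    the vector of observed values. *)
Definition mindist (m : K -> R) : I :=
  [arg min_(i < i0) discrepancy m i]%O.

(** The selected candidate fits the observations at least as well as [i]. *)
Lemma mindist_le (m : K -> R) (i : I) (a : K) (e : R) : 0 <= e ->
  (forall c, `|Q i c - m c| <= e) -> `|Q (mindist m) a - m a| <= e.
Proof.
move=> e0 he; apply: (@le_trans _ _ (discrepancy m i)); last exact: bigmax_le.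
rewrite /mindist; case: arg_minP => // j _ /(_ i isT); apply: le_trans.
exact: (le_bigmax _ (fun c => `|Q j c - m c|)).
Qed.

End mindist.

Section patterns.
Context {disp : measure_display} {T : measurableType disp} {K I : finType}.
Variables (n : nat) (A : K -> set T).
Hypothesis mA : forall a, measurable (A a).

(** The information in the sample used by the selection, as an element of a
    finite type, so that every function of it is measurable. *)
Definition pattern (s : n.-tuple T) : {ffun 'I_n * K -> bool} :=
  [ffun la => tnth s la.1 \in A la.2].

Lemma measurable_pattern (h : {ffun 'I_n * K -> bool} -> I) (i : I) :
  measurable [set s | h (pattern s) = i].
Proof.
rewrite (_ : [set s | _] = \bigcup_(phi in [set phi | h phi = i])
    \bigcap_(la in [set: 'I_n * K])
      [set s | (tnth s la.1 \in A la.2) = phi la]).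
  apply: fin_bigcup_measurable => // phi _.
  apply: fin_bigcap_measurable => // -[l a] _ /=.
  have mB : measurable [set s : n.-tuple T | A a (tnth s l)].
    rewrite -[X in measurable X]setTI.
    exact: (measurable_tnth l measurableT (mA a)).
  case: (phi (l, a)).
    rewrite (_ : [set s | _] = [set s | A a (tnth s l)])//.
    by apply/seteqP; split => s /=; [exact: set_mem|exact: mem_set].
  rewrite (_ : [set s | _] = ~` [set s | A a (tnth s l)]).
    exact: measurableC.
  apply/seteqP; split => s /=; first by move=> /negbT; rewrite notin_setE.
  by move=> /mem_set; rewrite in_setC => /negbTE.
apply/seteqP; split => [s /= hs|s /= [phi /= <- sphi]].
  by exists (pattern s) => //= la _ /=; rewrite ffunE.
by congr h; apply/ffunP => la; rewrite ffunE; exact: sphi.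
Qed.

End patterns.


Lemma finite_union_bound {disp : measure_display} {T : measurableType disp}
    {R : realType} (mu : {measure set T -> \bar R}) (J : finType)
    (A : set T) (B : J -> set T) (c : R) :
  measurable A -> (forall j, measurable (B j)) -> A `<=` \bigcup_j B j ->
  (forall j, mu (B j) <= c%:E)%E -> (mu A <= (#|J|%:R * c)%:E)%E.
Proof.
move=> mA mB AB Bc.
have := @content_sub_fsum _ _ _ mu J [set` index_enum J] A B
  (finite_seq _) (fun j _ => mB j) mA.
rewrite -fsbig_seq ?index_enum_uniq// => /(_ _)/le_trans; apply.
  by move=> x /AB[j _ Bjx]; exists j => //=; rewrite mem_index_enum.
rewrite (le_trans (lee_sum _ (fun j _ => Bc j)))//.
by rewrite sumEFin sumr_const mulr_natl.
Qed.

Section mindist_estimator.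
Context {disp : measure_display} {T : measurableType disp} {R : realType}.
Variable mu : {measure set T -> \bar R}.
Variables (I : finType) (i0 : I) (f : I -> T -> R).
Hypothesis pf : forall i, pdf mu (f i).

Definition scheffe_set (ij : I * I) : set T := [set x | f ij.2 x < f ij.1 x].

Definition empirical (n : nat) (phi : {ffun 'I_n * (I * I) -> bool})
    (ij : I * I) : R := (\sum_(l < n) (phi (l, ij))%:R) / n%:R.

Definition model_mass (i : I) (ij : I * I) : R :=
  \int[mu]_(x in scheffe_set ij) f i x.

Definition mindist_selector (n : nat) (s : n.-tuple T) : I :=
  mindist i0 model_mass (empirical (pattern scheffe_set s)).

Lemma measurable_scheffe_set ij : measurable (scheffe_set ij).
Proof.
have [mf _ _] := pf ij.1; have [mg _ _] := pf ij.2.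
rewrite -[scheffe_set ij]setTI.
have := measurable_fun_ltr mg mf measurableT (Logic.I : measurable [set true]).
exact.
Qed.

Lemma measurable_mindist_selector n i :
  measurable [set s : n.-tuple T | mindist_selector s = i].
Proof.
exact: (measurable_pattern measurable_scheffe_set
          (fun phi => mindist i0 model_mass (empirical phi))).
Qed.

(** Yatracos' argument.  By Scheffe's identity the distance from the selected
    [f i] to [f j] is twice the difference of their masses on one Scheffe set.
    Both masses are close to the empirical frequency: that of [f j] because
    [f j] is close to [p], that of [f i] because the selection fits no worse
    than [j].  This gives [2 l1dist (f j) p + 4 e], to which the triangle
    inequality adds [l1dist (f j) p]. *)
Lemma mindist_selector_l1dist n (s : n.-tuple T) (p : T -> R) (e : R) (j : I) :
  pdf mu p -> 0 <= e ->
  (forall ij, `|\int[mu]_(x in scheffe_set ij) p x -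
                empirical (pattern scheffe_set s) ij| <= e) ->
  l1dist mu (f (mindist_selector s)) p <= 3 * l1dist mu (f j) p + 4 * e.
Proof.
move=> pp e0 he; set i := mindist_selector s.
apply: (le_trans (l1dist_triangle (pf i) (pf j) pp)).
rewrite (scheffe (pf i) (pf j)) -/(scheffe_set (i, j)).
set m := empirical _ in he.
have hj ij : `|model_mass j ij - m ij| <= l1dist mu (f j) p / 2 + e.
  have := mass_diff_le_l1dist (measurable_scheffe_set ij) (pf j) pp.
  rewrite -/(model_mass j ij).
  have := he ij; have := ler_distD (\int[mu]_(x in scheffe_set ij) p x)
    (model_mass j ij) (m ij); lra.
have d0 : 0 <= l1dist mu (f j) p by apply: Rintegral_ge0.
have hi : `|model_mass i (i, j) - m (i, j)| <= l1dist mu (f j) p / 2 + e.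
  by apply: (mindist_le _ (i := j)) => //; lra.
have := hj (i, j).
move: hi; rewrite !ler_norml -/(model_mass i (i, j)) -/(model_mass j (i, j)).
lra.
Qed.

(** Union bound over the upper deviations of the frequencies of the Scheffe sets
    and of their complements, the latter being the lower deviations of the
    former. *)
Lemma mindist_selector_risk n (p : T -> R) (P : probability T R) (e t : R)
    (j : I) : (0 < n)%N -> pdf mu p ->
  (P : set T -> \bar R) = (fun A => (\int[mu]_(x in A) (p x)%:E)%E) -> 0 < e ->
  3 * l1dist mu (f j) p + 4 * e <= t ->
  (tuple_measure P n [set s | t <
      l1dist mu (f (mindist_selector s)) p]%R <=
   (2 * #|I|%:R ^+ 2 * expR (- (3 / 4 * n%:R * e ^+ 2)))%:E)%E.
Proof.
move=> n0 pp PE e0 et.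
set Bad := [set s | _].
have nR : 0 < n%:R :> R by rewrite ltr0n.
have mBad : measurable Bad.
  rewrite (_ : Bad = \bigcup_(i in [set i | t < l1dist mu (f i) p])
      [set s | mindist_selector s = i]).
    apply: fin_bigcup_measurable => // i _.
    exact: measurable_mindist_selector.
  apply/seteqP; split => [s bs|s [i bi /= si]].
    by exists (mindist_selector s).
  by rewrite /Bad /= si.
have [e1|e1] := leP e 1; last first.
  (* no L1 distance of densities exceeds 2, so the bad event is empty *)
  rewrite (_ : Bad = set0).
    by rewrite measure0 lee_fin !mulr_ge0 ?expR_ge0// exprn_ge0.
  apply/seteqP; split => // s; rewrite /Bad /= ltNge => /negP; apply.
  apply: (le_trans (l1dist_le2 (pf _) pp)).
  have d0 : 0 <= l1dist mu (f j) p by apply: Rintegral_ge0.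
  by apply: le_trans et; lra.
pose side (b : bool) ij : set T :=
  if b then scheffe_set ij else ~` scheffe_set ij.
have mside b ij : measurable (side b ij).
  by case: b; [|apply: measurableC]; exact: measurable_scheffe_set.
have PE' A : fine (P A) = \int[mu]_(x in A) p x by rewrite PE.
pose dev (b : bool * (I * I)) : set (n.-tuple T) :=
  [set s | n%:R * (fine (P (side b.1 b.2)) + e) <=
           \sum_(l < n) \1_(side b.1 b.2) (tnth s l)].
have mdev b : measurable (dev b).
  pose S (s : n.-tuple T) : R := \sum_(l < n) \1_(side b.1 b.2) (tnth s l).
  have mS : measurable_fun setT S.
    apply: measurable_sum => l.
    have mI : measurable_fun setT (\1_(side b.1 b.2) : T -> R).
      exact: measurable_indic.
    exact: (measurableT_comp mI (measurable_tnth l)).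
  rewrite -[dev b]setTI.
  have := measurable_fun_ler
    (measurable_cst (n%:R * (fine (P (side b.1 b.2)) + e)))
    mS measurableT (Logic.I : measurable [set true]).
  exact.
have -> : 2 * #|I|%:R ^+ 2 * expR (- (3 / 4 * n%:R * e ^+ 2)) =
    #|{: bool * (I * I)}|%:R * expR (- (3 / 4 * n%:R * e ^+ 2)) :> R.
  by rewrite !card_prod card_bool !natrM expr2.
apply: (finite_union_bound mBad mdev); last first.
  by move=> b; apply: empirical_upper_tail => //; rewrite e0.
move=> s; rewrite /Bad /= => bs.
apply: contrapT => ndev; move: bs; apply/negP; rewrite -leNgt.
apply: le_trans et; apply: mindist_selector_l1dist => //; first exact: ltW.
move=> ij.
have h b : \sum_(l < n) \1_(side b ij) (tnth s l) <
           n%:R * (fine (P (side b ij)) + e).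
  by rewrite ltNge; apply/negP => hb; apply: ndev; exists (b, ij).
have h1 := h true; have h2 := h false.
have mS := measurable_scheffe_set ij.
rewrite /= !PE' in h1 h2; rewrite pdf_mass_setC// in h2.
set M := \int[mu]_(x in _) p x in h1 h2 *.
have E1 : \sum_(l < n) \1_(scheffe_set ij) (tnth s l) =
    n%:R * empirical (pattern scheffe_set s) ij.
  rewrite /empirical mulrC divfK ?gt_eqF//.
  by apply: eq_bigr => l _; rewrite ffunE indicE.
have E2 : \sum_(l < n) \1_(~` scheffe_set ij) (tnth s l) =
    n%:R * (1 - empirical (pattern scheffe_set s) ij).
  rewrite mulrBr mulr1 -E1.
  rewrite (_ : n%:R = \sum_(l < n) 1); last by rewrite sumr_const card_ord.
  rewrite -sumrB; apply: eq_bigr => l _; rewrite !indicE in_setC.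
  by case: (_ \in _) => /=; rewrite ?subrr ?subr0.
rewrite E1 ltr_pM2l// in h1; rewrite E2 ltr_pM2l// in h2.
rewrite ler_norml; lra.
Qed.

End mindist_estimator.

(** * Product densities *)

Definition prod_fun {R : realType} {T : Type} (d : nat) (p : 'I_d -> T -> R)
    (x : d.-tuple T) : R := \prod_(j < d) p j (tnth x j).

Section product_densities.
Context {disp : measure_display} {T : measurableType disp} {R : realType}.
Variable mu : {sigma_finite_measure set T -> \bar R}.

Lemma pdf_prod_fun d (p : 'I_d -> T -> R) :
  (forall j, pdf mu (p j)) -> pdf (tuple_measure mu d) (prod_fun p).
Proof.
move=> pp; have mp j : measurable_fun setT (p j) by have [] := pp j.
have p0 j x : 0 <= p j x by have [] := pp j.
split; first exact: measurable_prod_tnth.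
  by move=> x; apply: prodr_ge0.
rewrite ge0_integral_tuple_prod// big1// => j _.
by have [] := pp j.
Qed.

(** The factors of the [j]-th term in the telescoping of a difference of
    products: [p] before position [j], the distance at [j], [q] after it. *)
Definition hybrid d (p q : 'I_d -> T -> R) (j i : 'I_d) : T -> R :=
  if (i < j)%N then p i else
  if i == j then fun x => `|p i x - q i x| else q i.

Lemma distr_prod_le d (p q : 'I_d -> T -> R) (x : d.-tuple T) :
  (forall j y, 0 <= p j y) -> (forall j y, 0 <= q j y) ->
  `|prod_fun p x - prod_fun q x| <= \sum_(j < d) prod_fun (hybrid p q j) x.
Proof.
rewrite /prod_fun; elim: d p q x => [|d IHd] p q x p0 q0.
  by rewrite !big_ord0 subrr normr0.
rewrite !big_ord_recl.
have := IHd (fun j => p (lift ord0 j)) (fun j => q (lift ord0 j))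
  [tuple of behead x] (fun j => p0 _) (fun j => q0 _).
have tE i : tnth [tuple of behead x] i = tnth x (lift ord0 i).
  by move: (tnth x ord0) => x0; rewrite !(tnth_nth x0) lift0 /= nth_behead.
under eq_bigr do rewrite tE.
under [X in _ - X]eq_bigr do rewrite tE.
set P := \prod_(i < d) _; set Q := \prod_(i < d) _ => IH.
rewrite {1}/hybrid ltnn eqxx.
rewrite [X in _ <= _ + X](_ : _ = p ord0 (tnth x ord0) *
    \sum_(j < d) \prod_(j0 < d)
      hybrid (fun j => p (lift ord0 j)) (fun j => q (lift ord0 j)) j j0
        (tnth [tuple of behead x] j0)); last first.
  rewrite mulr_sumr; apply: eq_bigr => j _; rewrite big_ord_recl; congr (_ * _).
  by apply: eq_bigr => i _; rewrite tE.
have Q0 : 0 <= Q by apply: prodr_ge0.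
set p1 := p ord0 _; set q1 := q ord0 _; have p10 : 0 <= p1 by exact: p0.
have -> : p1 * P - q1 * Q = p1 * (P - Q) + (p1 - q1) * Q by ring.
apply: (le_trans (ler_normD _ _)).
rewrite !normrM (ger0_norm Q0) (ger0_norm p10).
by rewrite addrC lerD2l ler_wpM2l.
Qed.

(** Integrating the telescoping bound: in its [j]-th term all factors except the
    [j]-th are densities and integrate to 1. *)
Lemma l1dist_prod_fun d (p q : 'I_d -> T -> R) :
  (forall j, pdf mu (p j)) -> (forall j, pdf mu (q j)) ->
  l1dist (tuple_measure mu d) (prod_fun p) (prod_fun q) <=
  \sum_(j < d) l1dist mu (p j) (q j).
Proof.
move=> pp pq.
have mp j : measurable_fun setT (p j) by have [] := pp j.
have p0 j x : 0 <= p j x by have [] := pp j.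
have mq j : measurable_fun setT (q j) by have [] := pq j.
have q0 j x : 0 <= q j x by have [] := pq j.
have mh j i : measurable_fun setT (hybrid p q j i).
  rewrite /hybrid; case: ifP => // _; case: ifP => // _.
  by apply: measurableT_comp => //; exact: measurable_funB.
have h0 j i x : 0 <= hybrid p q j i x.
  by rewrite /hybrid; case: ifP => // _; case: ifP.
rewrite -lee_fin -l1distE; [|exact: pdf_prod_fun..].
apply: (@le_trans _ _ (\sum_(j < d) \int[tuple_measure mu d]_x
    (prod_fun (hybrid p q j) x)%:E)%E).
  rewrite -ge0_integral_sum//; last 2 first.
  - by move=> j; apply/measurable_EFinP; exact: measurable_prod_tnth.
  - by move=> j x _; rewrite lee_fin; apply: prodr_ge0.
  apply: ge0_le_integral => //.
  - apply/measurable_EFinP; apply: measurableT_comp => //.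
    by apply: measurable_funB; exact: measurable_prod_tnth.
  - apply: emeasurable_sum => j; apply/measurable_EFinP.
    exact: measurable_prod_tnth.
  - by move=> x _; rewrite sumEFin lee_fin; exact: distr_prod_le.
rewrite -sumEFin lee_sum// => j _.
rewrite ge0_integral_tuple_prod// (bigD1 j)//= big1 ?mule1; last first.
  move=> i ij; rewrite /hybrid; case: ifP => _; first by have [] := pp i.
  by rewrite (negbTE ij); have [] := pq i.
by rewrite -l1distE// /hybrid ltnn eqxx.
Qed.

End product_densities.

(** * Mixtures and rounded weights *)

Definition mix {R : realType} {T : Type} (k : nat) (w : 'I_k -> R)
    (F : 'I_k -> T -> R) (x : T) : R := \sum_(i < k) w i * F i x.

Section mixtures.
Context {disp : measure_display} {T : measurableType disp} {R : realType}.
Variable mu : {measure set T -> \bar R}.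

Lemma pdf_mix k (w : 'I_k -> R) (F : 'I_k -> T -> R) :
  simplex k w -> (forall i, pdf mu (F i)) -> pdf mu (mix w F).
Proof.
move=> [w0 w1] pF.
have mF i : measurable_fun setT (F i) by have [] := pF i.
have F0 i x : 0 <= F i x by have [] := pF i.
split.
- by apply: measurable_sum => i; exact: measurable_funM.
- by move=> x; apply: sumr_ge0 => i _; rewrite mulr_ge0.
rewrite (_ : (fun x => _) =
    fun x => \sum_(i < k) ((w i)%:E * (F i x)%:E)%E); last first.
  by apply/funext => x; rewrite -sumEFin.
rewrite ge0_integral_sum//; last 2 first.
- by move=> i; apply: measurable_funeM; exact/measurable_EFinP.
- by move=> i x _; rewrite -EFinM lee_fin mulr_ge0.
rewrite -[1%E]/(1%:E) -w1 -sumEFin; apply: eq_bigr => i _.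
rewrite ge0_integralZl_EFin//; last exact/measurable_EFinP.
  by have [_ _ ->] := pF i; rewrite mule1.
by move=> x _; rewrite lee_fin.
Qed.

Lemma l1dist_mix k (w v : 'I_k -> R) (F G : 'I_k -> T -> R) :
  simplex k w -> simplex k v ->
  (forall i, pdf mu (F i)) -> (forall i, pdf mu (G i)) ->
  l1dist mu (mix w F) (mix v G) <=
  \sum_(i < k) w i * l1dist mu (F i) (G i) + \sum_(i < k) `|w i - v i|.
Proof.
move=> sw sv pF pG; have [w0 w1] := sw.
have mF i : measurable_fun setT (F i) by have [] := pF i.
have F0 i x : 0 <= F i x by have [] := pF i.
have mG i : measurable_fun setT (G i) by have [] := pG i.
have G0 i x : 0 <= G i x by have [] := pG i.
have mFG i : measurable_fun setT (fun x => `|F i x - G i x|).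
  by apply: measurableT_comp => //; exact: measurable_funB.
rewrite -lee_fin -l1distE; [|exact: pdf_mix..].
pose h i x := w i * `|F i x - G i x| + `|w i - v i| * G i x.
have mh i : measurable_fun setT (h i).
  by apply: measurable_funD; exact: measurable_funM.
have h0 i x : 0 <= h i x by rewrite addr_ge0// mulr_ge0.
apply: (@le_trans _ _ (\sum_(i < k) \int[mu]_x (h i x)%:E)%E).
  rewrite -ge0_integral_sum//; last 2 first.
  - by move=> i; exact/measurable_EFinP.
  - by move=> i x _; rewrite lee_fin.
  apply: ge0_le_integral => //.
  - apply/measurable_EFinP; apply: measurableT_comp => //.
    apply: measurable_funB; apply: measurable_sum => i;
      exact: measurable_funM.
  - by apply: emeasurable_sum => i; exact/measurable_EFinP.
  move=> x _; rewrite sumEFin lee_fin /mix -sumrB.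
  rewrite (le_trans (ler_norm_sum _ _ _))// ler_sum// => i _.
  rewrite (_ : w i * F i x - v i * G i x =
    w i * (F i x - G i x) + (w i - v i) * G i x); last by ring.
  rewrite (le_trans (ler_normD _ _))// !normrM.
  by rewrite (ger0_norm (w0 i)) (ger0_norm (G0 i x)).
rewrite -big_split/= -sumEFin lee_sum// => i _.
have mFE := (measurable_EFinP setT _).2 (mFG i).
have mGE := (measurable_EFinP setT _).2 (mG i).
rewrite /h; under eq_integral do rewrite EFinD !EFinM.
rewrite ge0_integralD//; last 4 first.
- by move=> x _; rewrite -EFinM lee_fin mulr_ge0.
- exact: measurable_funeM.
- by move=> x _; rewrite -EFinM lee_fin mulr_ge0.
- exact: measurable_funeM.
rewrite !ge0_integralZl_EFin//; last by move=> x _; rewrite lee_fin.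
have [_ _ ->] := pG i.
by rewrite l1distE// mule1 -EFinM -EFinD.
Qed.

End mixtures.

Section normalized_counts.
Context {R : realType}.

(** The successor makes all counts positive, so that every [u] whatsoever yields
    a probability vector; rounding down and adding 1 is as precise as rounding
    down. *)
Definition normalized (n K : nat) (u : {ffun 'I_n -> 'I_K}) (i : 'I_n) : R :=
  (u i).+1%:R / \sum_(j < n) (u j).+1%:R.

Lemma simplex_normalized n K (u : {ffun 'I_n -> 'I_K}) : (0 < n)%N ->
  simplex n (normalized u).
Proof.
move=> n0.
have S0 : 0 < \sum_(j < n) (u j).+1%:R :> R.
  case: n n0 u => // n _ u; rewrite big_ord_recl ltr_pwDl ?ltr0n//.
  by apply: sumr_ge0 => j _.
split; first by move=> i; rewrite divr_ge0// ltW.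
by rewrite -mulr_suml divff// gt_eqF.
Qed.

(** The counts [u i + 1] with [u i] the integer part of [N * w i] are within 1
    of [N * w i], hence their sum is within [k] of [N]; the two effects
    contribute [k / N] each. *)
Lemma normalized_approx k N (w : 'I_k -> R) : (0 < k)%N -> (0 < N)%N ->
  simplex k w ->
  exists u : {ffun 'I_k -> 'I_N.+1},
    \sum_(i < k) `|w i - normalized u i| <= 2 * k%:R / N%:R.
Proof.
move=> k0 N0 [w0 w1].
have NR : 0 < N%:R :> R by rewrite ltr0n.
have wle1 i : w i <= 1.
  by rewrite -w1 (bigD1 i)//= lerDl; apply: sumr_ge0.
have uN i : (Num.truncn (N%:R * w i) < N.+1)%N.
  by rewrite truncn_lt_nat ?mulr_ge0// -natr1 ltr_pwDr// ler_piMr.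
pose u := [ffun i => Ordinal (uN i)] : {ffun 'I_k -> 'I_N.+1}.
exists u; pose S : R := \sum_(j < k) (u j).+1%:R.
have [v0 v1] := simplex_normalized u k0.
have uw i : `|(u i).+1%:R - N%:R * w i| <= 1.
  rewrite ffunE /=; have /andP[] := truncn_itv (mulr_ge0 (ler0n R N) (w0 i)).
  by rewrite ler_norml -natr1; lra.
have SN : `|S - N%:R| <= k%:R.
  rewrite (_ : S - N%:R = \sum_(i < k) ((u i).+1%:R - N%:R * w i)); last first.
    by rewrite sumrB -mulr_sumr w1 mulr1.
  rewrite (le_trans (ler_norm_sum _ _ _))//.
  rewrite (le_trans (ler_sum _ (fun i _ => uw i)))//.
  by rewrite sumr_const card_ord.
have S0 : 0 < S.
  rewrite /S; case: (k) k0 (u) => // m _ t.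
  rewrite big_ord_recl ltr_pwDl ?ltr0n//.
  by apply: sumr_ge0 => j _.
have bnd i : `|w i - normalized u i| <=
    N%:R^-1 + normalized u i * (k%:R / N%:R).
  rewrite (_ : w i - normalized u i = (N%:R * w i - (u i).+1%:R) / N%:R +
     normalized u i * ((S - N%:R) / N%:R)); last first.
    by rewrite /normalized -/S; field; rewrite !gt_eqF.
  rewrite (le_trans (ler_normD _ _))// lerD//.
    rewrite normrM distrC normfV (ger0_norm (ltW NR)).
    by rewrite ler_piMl ?uw ?invr_ge0 ?ltW.
  rewrite normrM (ger0_norm (v0 i)) ler_wpM2l//.
  by rewrite normrM normfV (ger0_norm (ltW NR)) ler_wpM2r// invr_ge0 ltW.
rewrite (le_trans (ler_sum _ (fun i _ => bnd i)))//.
rewrite big_split/= -mulr_suml v1 sumr_const card_ord.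
rewrite -mulr_natl; lra.
Qed.

End normalized_counts.

(** * Histograms approximating a Lipschitz density *)

Section univariate.
Context {R : realType}.
Local Notation leb := (@lebesgue_measure R).
Local Notation T := (measurableTypeR R).

Lemma mem_bin (b : nat) (i : nat) (x : R) : (0 < b)%N -> 0 <= x ->
  (x \in `[i%:R / b%:R, i.+1%:R / b%:R[) = (Num.truncn (b%:R * x) == i).
Proof.
move=> b0 x0; have bR : 0 < b%:R :> R by rewrite ltr0n.
rewrite truncn_eq ?mulr_ge0// in_itv /= ler_pdivrMr// ltr_pdivlMr//.
by rewrite (mulrC x).
Qed.

Lemma pdf_hist1 (b : nat) (i : 'I_b) : (0 < b)%N ->
  pdf leb (hist1 b i : T -> R).
Proof.
move=> b0; have bR : 0 < b%:R :> R by rewrite ltr0n.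
split.
- by apply: measurable_funM => //; exact: measurable_indic.
- by move=> x; rewrite mulr_ge0.
rewrite /hist1; under eq_integral do rewrite EFinM.
rewrite ge0_integralZl_EFin//; last first.
  by apply/measurable_EFinP; exact: measurable_indic.
rewrite integral_indic//= setIT lebesgue_measure_itv/=.
rewrite lte_fin ltr_pM2r ?invr_gt0// ltr_nat ltnSn -EFinB -EFinM.
by congr EFin; rewrite -mulrBl -natrB// subSnn mul1r divff// gt_eqF.
Qed.

Lemma mix_hist1_out (b : nat) (v : 'I_b -> R) (x : R) : (0 < b)%N ->
  x \notin `[0, 1[ -> mix v (hist1 b) x = 0.
Proof.
move=> b0 x01; have bR : 0 < b%:R :> R by rewrite ltr0n.
rewrite /mix big1// => i _; rewrite /hist1 indicE memNset ?mulr0//.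
move=> /=; rewrite in_itv /= => /andP[ix xi]; move/negP: x01; apply.
rewrite in_itv /=; apply/andP; split.
  by apply: le_trans ix; rewrite divr_ge0.
by apply: (lt_le_trans xi); rewrite ler_pdivrMr// mul1r ler_nat.
Qed.

Lemma mix_hist1_in (b : nat) (v : 'I_b -> R) (x : R) (i : 'I_b) : (0 < b)%N ->
  0 <= x -> i = Num.truncn (b%:R * x) :> nat -> mix v (hist1 b) x = v i * b%:R.
Proof.
move=> b0 x0 ix; rewrite /mix (bigD1 i)//= big1 ?addr0; last first.
  move=> j ji; rewrite /hist1 indicE memNset ?mulr0//=.
  by rewrite mem_bin// -ix eq_sym; move/negP: ji.
by rewrite /hist1 indicE mem_set ?mulr1//= mem_bin// ix.
Qed.

Section lipschitz_density.
Variables (L : R) (q : R -> R).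
Hypothesis L_ge0 : 0 <= L.
Hypothesis qL : Lip L q.

Lemma Lip_dist x y : x \in `[0, 1] -> y \in `[0, 1] ->
  `|q x - q y| <= L * `|x - y|.
Proof.
move=> x01 y01; have [lq _ _] := qL.
exact: (lq (x, y)).
Qed.

(** Composing [q] with the retraction of the line onto the unit interval gives a
    function which is Lipschitz, hence continuous, on the whole line. *)
Lemma Lip_measurable : measurable_fun `[0 : R, 1]%classic q.
Proof.
pose cl (x : R) : R := if x < 0 then 0 else if 1 < x then 1 else x.
have cl01 x : cl x \in `[0, 1].
  rewrite in_itv /= /cl; case: ltP => // ?; first by rewrite lexx ler01.
  by case: ltP => ?; [rewrite ler01 lexx|apply/andP].
have cl_id x : x \in `[0, 1] -> cl x = x.
  by rewrite in_itv /= => /andP[x0 x1]; rewrite /cl ltNge x0 /= ltNge x1.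
have cl_dist x y : `|cl x - cl y| <= `|x - y|.
  have := ler_norm (x - y); have := ler_norm (y - x); rewrite (distrC y).
  rewrite /cl ler_norml; case: (ltP x 0) => ?; [|case: (ltP 1 x) => ?];
  by (case: (ltP y 0) => ?; [|case: (ltP 1 y) => ?]) => ? ?; lra.
have cq : continuous (q \o cl).
  move=> x; apply/cvgrPdist_le => e e0.
  have d0 : 0 < e / (1 + L) by rewrite divr_gt0// ltr_pwDl.
  apply: filterS (@cvgr_dist_le _ _ _ (nbhs x) _ id x cvg_id _ d0) => y xy.
  apply: (le_trans (Lip_dist (cl01 x) (cl01 y))).
  apply: (@le_trans _ _ (L * (e / (1 + L)))); last first.
    rewrite mulrA ler_pdivrMr ?ltr_pwDl//.
    by rewrite mulrDr mulr1 (mulrC L) lerDr ltW.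
  rewrite ler_wpM2l// (le_trans (cl_dist _ _))//.
apply: (@eq_measurable_fun _ _ _ _ _ (q \o cl)).
  by move=> x /set_mem /= x01; rewrite /= cl_id.
exact: measurable_funS (continuous_measurable_fun cq).
Qed.

(** Otherwise [q] would be at least [q x - L > 1] on the whole unit interval. *)
Lemma Lip_le x : x \in `[0, 1] -> q x <= 1 + L.
Proof.
move=> x01; rewrite leNgt; apply/negP => qx.
have [_ q0 q1] := qL.
have : ((q x - L)%:E <= 1)%E.
  rewrite -q1 -[leLHS]mule1.
  have <- : leb `[0, 1]%classic = 1%E.
    by rewrite lebesgue_measure_itv /= lte_fin ltr01 sube0.
  rewrite -integral_cst//; apply: ge0_le_integral => //.
  - by move=> y _; rewrite lee_fin; lra.
  - by apply/measurable_EFinP; exact: Lip_measurable.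
  move=> y /= y01; rewrite lee_fin.
  have := Lip_dist x01 y01.
  have : `|x - y| <= 1.
    move: x01 y01; rewrite !in_itv /= => /andP[? ?] /andP[? ?].
    by rewrite ler_norml; lra.
  move=> /(ler_wpM2l L_ge0).
  have := ler_norm (q x - q y); lra.
by rewrite lee_fin; lra.
Qed.

Definition restrict01 : T -> R := q \_ `[0, 1[%classic.

Lemma pdf_restrict01 : pdf leb restrict01.
Proof.
have [_ q0 q1] := qL.
split.
- apply/(measurable_restrictT _ _).1 => //.
  apply: measurable_funS Lip_measurable => //.
  by move=> x /=; rewrite !in_itv /= => /andP[-> /ltW].
- move=> x; rewrite /restrict01 patchE; case: ifPn => // /set_mem /= x01.
  by apply: q0; move: x01; rewrite !in_itv /= => /andP[-> /ltW].
rewrite -q1 (_ : (fun x => _) = (EFin \o q) \_ `[0 : R, 1[%classic); last first.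
  by rewrite restrict_EFin.
rewrite -integral_mkcond integral_itv_bndo_bndc//.
apply/measurable_EFinP; apply: measurable_funS Lip_measurable => //.
by move=> x /=; rewrite !in_itv /= => /andP[-> /ltW].
Qed.

(** The unnormalised histogram with height [(u m + 1) / b] on bin [m], where
    [u m] is the integer part of [b * q (m / b)], is within [L / b] (variation
    of [q] over a bin) plus [1 / b] (rounding) of [q].  Its mass [c] is then
    within the same [eta = (1 + L) / b] of 1, so normalising at most doubles the
    error, and [2 eta <= 3 L / b] as [L >= 2]. *)
Lemma Lip_hist_approx b : (0 < b)%N -> 2 <= L ->
  exists u : {ffun 'I_b -> 'I_(Num.truncn (b%:R * (1 + L))).+1},
    l1dist leb restrict01 (mix (normalized u) (hist1 b) : T -> R) <=
    3 * (L / b%:R).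
Proof.
move=> b0 L2; have bR : 0 < b%:R :> R by rewrite ltr0n.
have [_ q0 _] := qL.
have node01 (m : 'I_b) : m%:R / b%:R \in `[0 : R, 1].
  rewrite in_itv /=; apply/andP; split; first by rewrite divr_ge0.
  by rewrite ler_pdivrMr// mul1r ler_nat ltnW.
have uK (m : 'I_b) :
    (Num.truncn (b%:R * q (m%:R / b%:R)) < (Num.truncn (b%:R * (1 + L))).+1)%N.
  by rewrite ltnS le_truncn// ler_pM2l// Lip_le.
pose u : {ffun 'I_b -> 'I_(Num.truncn (b%:R * (1 + L))).+1} :=
  [ffun m => Ordinal (uK m)].
exists u; set h := mix _ _.
pose S : R := \sum_(j < b) (u j).+1%:R.
have S0 : 0 < S.
  rewrite /S; case: (b) b0 (u) => // m _ t.
  rewrite big_ord_recl ltr_pwDl ?ltr0n//.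
  by apply: sumr_ge0 => j _.
pose c : R := S / b%:R ^+ 2.
have pq := pdf_restrict01.
have ph : pdf leb h.
  apply: pdf_mix; first exact: simplex_normalized.
  by move=> i; exact: pdf_hist1.
have [_ h0 _] := ph.
pose eta : R := (1 + L) / b%:R.
have L_eta : 0 <= eta by rewrite divr_ge0// addr_ge0.
have pointwise x : `|restrict01 x - c * h x| <= eta * \1_(`[0, 1[%classic) x.
  have [x01|x01] := boolP (x \in `[0, 1[); last first.
    rewrite /restrict01 patchE memNset; last exact/negP.
    by rewrite /h mix_hist1_out// mulr0 subr0 normr0 mulr_ge0.
  rewrite /restrict01 patchE mem_set//= indicE mem_set//= mulr1.
  move: (x01); rewrite in_itv /= => /andP[x0 x1].
  have mb : (Num.truncn (b%:R * x) < b)%N.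
    by rewrite truncn_lt_nat ?mulr_ge0// gtr_pMr.
  pose m := Ordinal mb.
  rewrite /h (@mix_hist1_in _ _ x m)//.
  have -> : c * (normalized u m * b%:R) = (u m).+1%:R / b%:R.
    by rewrite /c /normalized -/S; field; rewrite !gt_eqF.
  pose y : R := m%:R / b%:R.
  have y01 := node01 m.
  have hx : x \in `[m%:R / b%:R, m.+1%:R / b%:R[ by rewrite mem_bin.
  have xy : `|x - y| <= b%:R^-1.
    move: hx; rewrite in_itv /= => /andP[h1 h2].
    rewrite ger0_norm ?subr_ge0// lerBlDl /y -{2}[b%:R^-1]mul1r -mulrDl natr1.
    exact: ltW.
  have x01' : x \in `[0, 1] by rewrite in_itv /= x0 ltW.
  have d1 := Lip_dist x01' y01.
  have d2 : `|q y - (u m).+1%:R / b%:R| <= b%:R^-1.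
    rewrite ffunE /=.
    have /andP[t1 t2] := truncn_itv (mulr_ge0 (ltW bR) (q0 _ y01)).
    rewrite -/y in t1 t2 *; set t := Num.truncn _ in t1 t2 *.
    rewrite (_ : q y - _ = (b%:R * q y - t.+1%:R) * b%:R^-1); last first.
      by field; rewrite gt_eqF.
    rewrite normrM [X in _ * X]ger0_norm ?invr_ge0// ler_piMl ?invr_ge0//.
    by rewrite ler_norml; move: t2; rewrite -natr1; lra.
  rewrite (le_trans (ler_distD (q y) _ _))//.
  have : L * `|x - y| <= L * b%:R^-1 by rewrite ler_wpM2l.
  rewrite /eta mulrDl mul1r; lra.
have mh : measurable_fun setT h by have [] := ph.
have mq : measurable_fun setT restrict01 by have [] := pq.
have c0 : 0 <= c by rewrite divr_ge0// ltW.
have mD : measurable_fun setT (fun x : T => `|restrict01 x - c * h x|).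
  apply: measurableT_comp => //; apply: measurable_funB => //.
  exact: measurable_funM.
have intD : (\int[leb]_x `|restrict01 x - c * h x|%:E <= eta%:E)%E.
  apply: (@le_trans _ _
      (\int[leb]_x (eta%:E * (\1_(`[0%R, 1%R[%classic) x)%:E))%E).
    apply: ge0_le_integral => //.
    - exact/measurable_EFinP.
    - apply: measurable_funeM; apply/measurable_EFinP.
      exact: measurable_indic.
    - by move=> x _; rewrite -EFinM lee_fin; exact: pointwise.
  rewrite ge0_integralZl_EFin//; last first.
    by apply/measurable_EFinP; exact: measurable_indic.
  rewrite integral_indic//= setIT lebesgue_measure_itv/= lte_fin ltr01.
  by rewrite sube0 mule1.
have ich : leb.-integrable setT (EFin \o (fun x => c * h x)).
  exact: (integrableZl measurableT c (pdf_integrable ph)).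
have iq := pdf_integrable pq.
have iD : leb.-integrable setT (EFin \o (fun x => restrict01 x - c * h x)).
  exact: (integrableB measurableT iq ich).
have RD : \int[leb]_x `|restrict01 x - c * h x| <= eta.
  rewrite -lee_fin /Rintegral fineK//.
  by apply: integrable_fin_num => //; exact: (integrable_norm iD).
have c1 : `|1 - c| <= eta.
  apply: le_trans RD; rewrite -{1}(pdf_Rintegral pq) -[c in X in X <= _]mulr1.
  rewrite -[X in c * X](pdf_Rintegral ph) -RintegralZl//; last first.
    exact: pdf_integrable.
  by rewrite -RintegralB//; exact: le_normr_Rintegral.
have ih : leb.-integrable setT (EFin \o (fun x => `|1 - c| * h x)).
  exact: (integrableZl measurableT `|1 - c| (pdf_integrable ph)).
apply: (@le_trans _ _ (eta + eta)); last first.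
  by rewrite /eta -mulrDl mulrA ler_wpM2r ?invr_ge0//; lra.
apply: (@le_trans _ _
    (\int[leb]_x (`|restrict01 x - c * h x| + `|1 - c| * h x))).
  apply: le_Rintegral => //.
  - exact: pdf_integrable_dist.
  - exact: (integrableD measurableT (integrable_norm iD) ih).
  move=> x _; rewrite -[X in _ <= _ + _ * X](ger0_norm (h0 x)) -normrM.
  rewrite (_ : restrict01 x - h x =
    (restrict01 x - c * h x) - (1 - c) * h x); last by ring.
  exact: ler_normB.
rewrite RintegralD//; last exact: (integrable_norm iD).
rewrite lerD// RintegralZl//; last exact: pdf_integrable.
by rewrite (pdf_Rintegral ph) mulr1.
Qed.

End lipschitz_density.
End univariate.

(** * A finite net of multi-view histograms *)

Section histogram_hull.
Context {R : realType}.

(** Induction on the number of points: a combination is a two-point combination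
    of the first point and the renormalised remainder. *)
Lemma convex_mix (C : set (R -> R)) n (v : 'I_n -> R) (h : 'I_n -> R -> R) :
  @convex_set R (R -> R) C -> simplex n v -> (forall i, C (h i)) ->
  C (mix v h).
Proof.
move=> cC; elim: n v h => [|n IHn] v h [v0 v1] Ch.
  by move: v1; rewrite big_ord0 => /eqP; rewrite eq_sym oner_eq0.
move: v1; rewrite big_ord_recl => v1.
have s0 : 0 <= \sum_(i < n) v (lift ord0 i) by apply: sumr_ge0.
have [s_eq0|s_neq0] := eqVneq (\sum_(i < n) v (lift ord0 i)) 0.
  suff -> : mix v h = h ord0 by exact: Ch.
  apply/funext => x; rewrite /mix big_ord_recl big1 ?addr0.
    by move: v1; rewrite s_eq0 addr0 => ->; rewrite mul1r.
  move=> i _.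
  by rewrite (psumr_eq0P (fun i _ => v0 (lift ord0 i)) s_eq0) ?mul0r.
set s := \sum_(i < n) _ in v1 s0 s_neq0.
pose v' i := v (lift ord0 i) / s.
have sv' : simplex n v'.
  split; first by move=> i; rewrite divr_ge0.
  by rewrite -mulr_suml divff.
have Cmix := IHn v' (fun i => h (lift ord0 i)) sv' (fun i => Ch _).
have v0_le1 : v ord0 <= 1 by rewrite -v1 lerDl.
have := cC (h ord0) (mix v' (fun i => h (lift ord0 i)))
  (Itv01 (v0 ord0) v0_le1) (mem_set (Ch _)) (mem_set Cmix).
move=> /set_mem; congr C; apply/funext => x.
transitivity (v ord0 * h ord0 x +
  (1 - v ord0) * mix v' (fun i => h (lift ord0 i)) x); first by [].
have -> : 1 - v ord0 = s by rewrite -v1 addrC addKr.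
rewrite [RHS]/mix big_ord_recl {1}/mix mulr_sumr; congr (_ + _).
by apply: eq_bigr => i _; rewrite mulrA /v' (mulrC s) divfK.
Qed.

Lemma Hist1_mix b (v : 'I_b -> R) : simplex b v -> Hist1 b (mix v (hist1 b)).
Proof.
move=> sv A [cA hA]; apply: convex_mix => // i.
by apply: hA; exists i.
Qed.

End histogram_hull.

Lemma notin_cube {R : realType} d (x : d.-tuple (measurableTypeR R)) :
  ~ cube d x -> exists j, tnth x j \notin `[0 : R, 1[.
Proof.
move=> xc; apply: contrapT => H; apply: xc => j.
by apply: contrapT => xj; apply: H; exists j; apply/negP.
Qed.

Section net.
Context {R : realType}.
Variables d k b N K : nat.
Hypotheses (k0 : (0 < k)%N) (b0 : (0 < b)%N).
Local Notation T := (measurableTypeR R).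

(** The first component holds the counts of the mixture weights, the second one
    the counts of the histogram of each factor. *)
Definition net_index : finType :=
  ({ffun 'I_k -> 'I_N.+1} * {ffun 'I_k * 'I_d -> {ffun 'I_b -> 'I_K}})%type.

Definition net (a : net_index) : d.-tuple T -> R :=
  mix (normalized a.1)
      (fun i => prod_fun (fun j => mix (normalized (a.2 (i, j))) (hist1 b))).

Lemma Hist_net a : Hist d b k (net a).
Proof.
exists (normalized a.1), (fun i j => mix (normalized (a.2 (i, j))) (hist1 b)).
split => //; first exact: simplex_normalized.
by move=> i j; apply: Hist1_mix; exact: simplex_normalized.
Qed.

Lemma pdf_net a : pdf (@lebesgue_tuple R d) (net a).
Proof.
apply: pdf_mix => [|i]; first exact: simplex_normalized.
apply: pdf_prod_fun => j; apply: pdf_mix; first exact: simplex_normalized.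
by move=> m; exact: pdf_hist1.
Qed.

Lemma net_out a x : ~ cube d x -> net a x = 0.
Proof.
move=> /notin_cube[j xj].
rewrite /net {1}/mix big1// => i _; rewrite /prod_fun (bigD1 j)//=.
by rewrite mix_hist1_out// mul0r mulr0.
Qed.

Lemma card_net_index : #|net_index| = (N.+1 ^ k * (K ^ b) ^ (k * d))%N.
Proof. by rewrite card_prod !card_ffun card_prod !card_ord. Qed.

End net.

Section cube_restriction.
Context {R : realType}.
Variables (d k : nat).
Local Notation leb := (@lebesgue_measure R).
Local Notation T := (measurableTypeR R).

(** Densities are only constrained on the cube; cutting them off outside turns
    statements about the cube into statements about total functions. *)
Definition on_cube (p : d.-tuple T -> R) : d.-tuple T -> R := p \_ (@cube R d).

(** The indicator of the cube is the product of the indicators of its sides. *)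
Lemma on_cube_multiview (w : 'I_k -> R) (q : 'I_k -> 'I_d -> R -> R) :
  on_cube (fun x => \sum_(i < k) w i * \prod_(j < d) q i j (tnth x j)) =
  mix w (fun i => prod_fun (fun j => restrict01 (q i j))).
Proof.
apply/funext => x; rewrite /on_cube patchE.
have [xc|xc] := pselect (@cube R d x).
  rewrite mem_set//; apply: eq_bigr => i _; congr (_ * _).
  by apply: eq_bigr => j _; rewrite /restrict01 patchE mem_set//; exact: xc.
rewrite memNset//; have [j xj] := notin_cube xc.
rewrite {1}/mix big1// => i _; rewrite /prod_fun (bigD1 j)//=.
by rewrite {1}/restrict01 patchE memNset ?mul0r ?mulr0//; exact/negP.
Qed.

Lemma pdf_on_cube (L : R) p : 0 <= L -> multiview d k (Lip L) p ->
  pdf (@lebesgue_tuple R d) (on_cube p).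
Proof.
move=> L0 [w [q [sw qL ->]]]; rewrite on_cube_multiview.
apply: pdf_mix => // i; apply: pdf_prod_fun => j.
exact: pdf_restrict01 (qL i j).
Qed.

Lemma L1norm_l1dist (f p : d.-tuple T -> R) :
  pdf (@lebesgue_tuple R d) f -> pdf (@lebesgue_tuple R d) (on_cube p) ->
  (forall x, ~ cube d x -> f x = 0) ->
  L1norm (fun x => f x - p x) = (l1dist (@lebesgue_tuple R d) f (on_cube p))%:E.
Proof.
move=> pf pp f0; rewrite -l1distE// /L1norm Lnorm1; apply: eq_integral => x _.
rewrite /on_cube !patchE; case: ifPn => //= xc.
by rewrite f0 ?subr0 ?normr0//; move=> /mem_set; rewrite (negbTE xc).
Qed.

Lemma density_lawE (p : d.-tuple T -> R) :
  density_law p =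
  fun A => (\int[@lebesgue_tuple R d]_(x in A) (on_cube p x)%:E)%E.
Proof.
apply/funext => A; rewrite /density_law integral_mkcondr.
by apply: eq_integral => x _; rewrite /on_cube !patchE; case: ifP.
Qed.

(** With counts of total about [k b] the rounding of the weights costs [2 / b],
    which is at most the error [3 L / b] of a single factor. *)
Lemma net_approx (L : R) b p : 2 <= L -> (0 < k)%N -> (0 < b)%N ->
  multiview d k (Lip L) p ->
  exists a : net_index d k b (k * b) (Num.truncn (b%:R * (1 + L))).+1,
    l1dist (@lebesgue_tuple R d) (net a) (on_cube p) <=
    3 * d%:R * (L / b%:R) + 2 / b%:R.
Proof.
move=> L2 k0 b0 [w [q [sw qL ->]]]; rewrite on_cube_multiview.
have L0 : 0 <= L by lra.
have kb0 : (0 < k * b)%N by rewrite muln_gt0 k0.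
have [u wu] := normalized_approx k0 kb0 sw.
have /choice[v hv] ij := Lip_hist_approx L0 (qL ij.1 ij.2) b0 L2.
exists (u, [ffun ij => v ij]).
have [u0 u1] := simplex_normalized (R := R) u k0.
have ph (i : 'I_k) (j : 'I_d) : pdf leb
    (mix (normalized ([ffun ij => v ij] (i, j))) (hist1 b) : T -> R).
  apply: pdf_mix; first exact: simplex_normalized.
  by move=> m; exact: pdf_hist1.
have pr i j : pdf leb (restrict01 (q i j)) by exact: pdf_restrict01 (qL i j).
apply: (le_trans (l1dist_mix (simplex_normalized (R := R) u k0) sw
  (fun i => pdf_prod_fun (ph i)) (fun i => pdf_prod_fun (pr i)))).
apply: lerD.
  apply: (@le_trans _ _
      (\sum_(i < k) normalized u i * (3 * d%:R * (L / b%:R)))).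
    apply: ler_sum => i _; rewrite ler_wpM2l//.
    apply: (le_trans (l1dist_prod_fun (ph i) (pr i))).
    apply: (@le_trans _ _ (\sum_(j < d) 3 * (L / b%:R))).
      apply: ler_sum => j _; rewrite ffunE.
      have := hv (i, j); congr (_ <= _); apply: eq_Rintegral => x _.
      exact: distrC.
    by rewrite sumr_const card_ord -[leLHS]mulr_natl [leLHS]mulrCA [leLHS]mulrA.
  by rewrite -mulr_suml u1 mul1r.
rewrite (eq_bigr (fun i => `|w i - normalized u i|)); last first.
  by move=> i _; exact: distrC.
apply: (le_trans wu); rewrite natrM invfM mulrA -(mulrA 2) divff ?mulr1//.
by rewrite pnatr_eq0 -lt0n.
Qed.

End cube_restriction.

(** * Choice of the number of bins *)

Section rates.
Context {R : realType}.
Variables (n d k : nat) (L : R).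
Hypotheses (n_gt0 : (0 < n)%N) (d_gt0 : (0 < d)%N) (k_gt0 : (0 < k)%N).
Hypothesis L_ge2 : 2 <= L.

(** The convergence rate at which bias and deviation balance, up to the factor
    [d] and the logarithm. *)
Definition rho : R := (k%:R * L / n%:R) `^ 3^-1.
Definition logterm : R := ln (3 * L * d%:R * k%:R * n%:R).
Definition bins : nat := (Num.truncn (2 * L / rho)).+1.

Let nR : 1 <= n%:R :> R. Proof. by rewrite ler1n. Qed.
Let dR : 1 <= d%:R :> R. Proof. by rewrite ler1n. Qed.
Let kR : 1 <= k%:R :> R. Proof. by rewrite ler1n. Qed.

Let n_pos : 0 < n%:R :> R. Proof. by rewrite ltr0n. Qed.
Let d_pos : 0 < d%:R :> R. Proof. by rewrite ltr0n. Qed.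
Let k_pos : 0 < k%:R :> R. Proof. by rewrite ltr0n. Qed.
Let L_pos : 0 < L. Proof. exact: lt_le_trans L_ge2. Qed.

Lemma rho_gt0 : 0 < rho.
Proof. by rewrite powR_gt0// divr_gt0// mulr_gt0. Qed.

Lemma rho_cube : rho ^+ 3 = k%:R * L / n%:R.
Proof.
rewrite -powR_mulrn ?powR_ge0// -powRrM mulVf ?pnatr_eq0// powRr1//.
by rewrite divr_ge0 ?mulr_ge0 ?ltW.
Qed.

(** [1 / 3 <= (d + 3) / 12] for [d >= 1], and [L >= 1]. *)
Lemma rho_le_rate :
  21 * d%:R * rho <=
  21 * d%:R * k%:R `^ 3^-1 * L `^ ((d%:R + 3) / 12) / n%:R `^ 3^-1.
Proof.
have L0 := ltW L_pos.
rewrite /rho powRM ?mulr_ge0 ?invr_ge0// powRM//.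
rewrite [X in _ * X](_ : _ =
    k%:R `^ 3^-1 * L `^ 3^-1 / n%:R `^ 3^-1); last first.
  by congr (_ * _); rewrite -powR_inv1 // -powRrM mulN1r powRN.
rewrite !mulrA ler_wpM2r ?invr_ge0 ?powR_ge0//.
rewrite ler_wpM2l ?mulr_ge0 ?powR_ge0//.
by apply: ler_powR; have := dR; have := L_ge2; lra.
Qed.

Lemma six_le_scale : 6 <= 3 * L * d%:R * k%:R * n%:R.
Proof.
rewrite (_ : 6 = 3 * 2 * 1 * 1 * 1 :> R); last by ring.
by do ![apply: ler_pM => //; rewrite ?mulr_ge0//]; lra.
Qed.

Lemma logterm_ge1 : 1 <= logterm.
Proof.
rewrite -[1]expRK /logterm ler_ln ?posrE ?expR_gt0//; last first.
  by apply: lt_le_trans six_le_scale.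
have := @expR1_le3 R; have := six_le_scale; lra.
Qed.

Lemma expR_logterm : expR logterm = 3 * L * d%:R * k%:R * n%:R.
Proof. by rewrite lnK// posrE (lt_le_trans _ six_le_scale). Qed.

Section fine_regime.
Hypothesis rho_small : 21 * rho < 2.

Lemma bins_gt : 2 * L / rho < bins%:R.
Proof. by rewrite truncnS_gt. Qed.

Lemma bins_le : bins%:R <= 2 * L / rho + 1.
Proof.
rewrite /bins -natr1 lerD2r truncn_le.
by rewrite divr_ge0 ?mulr_ge0 ?(ltW rho_gt0) ?(ltW L_pos).
Qed.

Lemma bins_ratio : L / bins%:R <= rho / 2.
Proof.
have := bins_gt; have r0 := rho_gt0.
have b0 : 0 < bins%:R :> R by rewrite ltr0n.
rewrite ltr_pdivrMr// ler_pdivrMr//; lra.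
Qed.

Lemma scale_eq : k%:R * L = n%:R * rho ^+ 3.
Proof. by rewrite rho_cube; field; rewrite gt_eqF. Qed.

Lemma bins_le_size : bins%:R <= 2 * n%:R / k%:R + 1 :> R.
Proof.
apply: (le_trans bins_le); rewrite lerD2r.
have r0 := rho_gt0; rewrite ler_pdivrMr// mulrAC ler_pdivlMr//.
rewrite -!mulrA ler_wpM2l// (mulrC L) scale_eq ler_wpM2l ?(ltW n_pos)//.
rewrite exprS ger_pMr// expr_le1 ?(ltW r0)//.
by have := rho_small; lra.
Qed.

(** As [rho <= 1], [2 L / rho <= 2 L / rho ^ 3 = 2 n / k]; hence both [k b + 1]
    and the number of heights of a bin, about [b (1 + L)], are at most the
    square of [3 L d k n]. *)
Lemma net_card_le :
  #|net_index d k bins (k * bins) (Num.truncn (bins%:R * (1 + L))).+1|%:R <=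
  expR (2 * logterm * (k%:R + k%:R * d%:R * bins%:R)).
Proof.
have b_size := bins_le_size.
have bk : k%:R * bins%:R <= 2 * n%:R + k%:R :> R.
  rewrite (le_trans (ler_wpM2l (ltW k_pos) b_size))//.
  by rewrite mulrDr mulr1 lerD2r mulrC divfK// gt_eqF.
have bn : bins%:R <= 2 * n%:R + 1 :> R.
  apply: (le_trans b_size); rewrite lerD2r ler_pdivrMr//.
  by rewrite ler_peMr ?mulr_ge0 ?(ltW n_pos).
set m : R := k%:R * n%:R.
have km : k%:R <= m by rewrite ler_peMr ?(ltW k_pos).
have nm : n%:R <= m by rewrite ler_peMl ?(ltW n_pos).
have m1 : 1 <= m by apply: le_trans km.
have Em : 3 * (L * m) <= expR logterm.
  rewrite expR_logterm /m (_ : 3 * L * d%:R * k%:R * n%:R =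
    (3 * (L * (k%:R * n%:R))) * d%:R); last by ring.
  by rewrite ler_peMr// !mulr_ge0// ltW.
have Lm : 2 * m <= L * m by rewrite ler_wpM2r// (le_trans _ m1).
set E := expR logterm in Em *.
have E2 : expR (2 * logterm) = E ^+ 2 by rewrite expRM_natl.
have E6 : 6 <= E by apply: le_trans Em; lra.
have EE : 6 * E <= E ^+ 2 by rewrite expr2 ler_wpM2r//; lra.
have hN : (k * bins).+1%:R <= expR (2 * logterm).
  by rewrite E2 -natr1 natrM; apply: le_trans EE; lra.
have hK : (Num.truncn (bins%:R * (1 + L))).+1%:R <= expR (2 * logterm).
  have /andP[h _] : (Num.truncn (bins%:R * (1 + L)))%:R <= bins%:R * (1 + L) <
      (Num.truncn (bins%:R * (1 + L))).+1%:R.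
    by apply: truncn_itv; rewrite mulr_ge0// addr_ge0// ltW.
  have h2 : bins%:R * (1 + L) <= (3 * m) * (3 / 2 * L).
    by apply: ler_pM => //; have := L_ge2; have := m1; lra.
  rewrite E2 -natr1; apply: le_trans EE; lra.
rewrite card_net_index natrM !natrX.
rewrite (_ : 2 * logterm * _ = k%:R * (2 * logterm) +
   (bins * (k * d))%:R * (2 * logterm)); last by rewrite !natrM; ring.
rewrite expRD (expRM_natl k) (expRM_natl (bins * (k * d))) -exprM.
by apply: ler_pM => //; rewrite ?exprn_ge0// lerXn2r ?nnegrE ?expR_ge0.
Qed.

(** [k L / rho = n rho ^ 2] by the choice of [rho], and smallness of [rho] makes
    [L / rho >= 21], which absorbs the rounding up of [bins] and the entropy of
    the weights in the factor [44 / 21] instead of [2]. *)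
Lemma net_entropy_le :
  2 * logterm * (k%:R + k%:R * d%:R * bins%:R) <=
  675 / 128 * n%:R * (d%:R * rho) ^+ 2 * logterm.
Proof.
have r0 := rho_gt0.
have L_rho : 21 <= L / rho.
  by rewrite ler_pdivlMr//; have := L_ge2; have := rho_small; lra.
have b1 : bins%:R + 1 <= 44 / 21 * (L / rho).
  by have := bins_le; rewrite -mulrA; lra.
rewrite -[leLHS]mulrA mulrCA [leRHS]mulrC ler_wpM2l//.
  by rewrite (le_trans _ logterm_ge1).
apply: (@le_trans _ _ (2 * (k%:R * d%:R * (bins%:R + 1)))).
  rewrite ler_wpM2l// mulrDr mulr1 addrC lerD2l.
  by rewrite ler_peMr// ltW.
have kLr : k%:R * (L / rho) = n%:R * rho ^+ 2.
  by rewrite mulrA scale_eq; field; rewrite gt_eqF.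
apply: (@le_trans _ _ (2 * (d%:R * (44 / 21 * (n%:R * rho ^+ 2))))).
  rewrite ler_wpM2l// -kLr [k%:R * d%:R]mulrC -[leLHS]mulrA.
  rewrite ler_wpM2l ?(ltW d_pos)//.
  by rewrite [leRHS]mulrCA ler_wpM2l ?(ltW k_pos).
have q0 : 0 <= n%:R * rho ^+ 2 by rewrite mulr_ge0 ?sqr_ge0 ?(ltW n_pos).
rewrite exprMn.
have dd : d%:R * (n%:R * rho ^+ 2) <= d%:R ^+ 2 * (n%:R * rho ^+ 2).
  by rewrite ler_wpM2r// expr2 ler_peMr// ltW.
have : 0 <= d%:R * (n%:R * rho ^+ 2) by rewrite mulr_ge0 ?(ltW d_pos).
by rewrite (mulrCA (d%:R ^+ 2) n%:R) in dd; lra.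
Qed.

End fine_regime.
End rates.

(** * The estimator *)

Lemma measurable_select {d1 d2 : measure_display} {S : measurableType d1}
    {T : measurableType d2} {R : realType} (I : finType) (sel : S -> I)
    (f : I -> T -> R) :
  (forall i, measurable [set s | sel s = i]) ->
  (forall i, measurable_fun setT (f i)) ->
  measurable_fun setT (fun z : S * T => f (sel z.1) z.2).
Proof.
move=> msel mf.
rewrite (_ : (fun z => _) = fun z : S * T =>
    \sum_(i : I) \1_([set s | sel s = i]) z.1 * f i z.2).
  apply: measurable_sum => i; apply: measurable_funM.
    have mI : measurable_fun setT (\1_([set s | sel s = i]) : S -> R).
      exact: measurable_indic.
    exact: measurableT_comp mI measurable_fst.
  exact: measurableT_comp (mf i) measurable_snd.
apply/funext => z; rewrite (bigD1 (sel z.1))//= big1 ?addr0.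
  by rewrite indicE mem_set// mul1r.
move=> i iz; rewrite indicE memNset ?mul0r// => /= zi.
by rewrite zi eqxx in iz.
Qed.

(** In [e ^ 2] the square of [7/4 a] pays for the confidence level, since
    [3/4 * 49/16 / 2 >= 1], and [B ^ 2] pays for the cardinality of the net; the
    mixed term is positive.  The result [2/3 delta] instead of [delta] makes the
    supremum over the class strictly smaller than [delta]. *)
Lemma failure_bound (R : realType) (n : nat) (delta M logM a B e : R) :
  (0 < n)%N -> 0 < delta -> delta <= 1 -> 0 <= M <= expR logM ->
  a = Num.sqrt (ln (3 / delta) / (2 * n%:R)) -> 0 <= B ->
  e = 7 / 4 * a + B -> 2 * logM <= 3 / 4 * n%:R * B ^+ 2 ->
  2 * M ^+ 2 * expR (- (3 / 4 * n%:R * e ^+ 2)) <= 2 / 3 * delta.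
Proof.
move=> n0 d0 d1 /andP[M0 Mle] aE B0 eE hB.
have nR : 0 < n%:R :> R by rewrite ltr0n.
have td : 1 <= 3 / delta by rewrite ler_pdivlMr//; lra.
have l0 : 0 <= ln (3 / delta) by rewrite ln_ge0.
have a2 : a ^+ 2 = ln (3 / delta) / (2 * n%:R).
  by rewrite aE sqr_sqrtr// divr_ge0// mulr_ge0 ?ltW.
have a0 : 0 <= a by rewrite aE sqrtr_ge0.
have na2 : n%:R * a ^+ 2 = ln (3 / delta) / 2.
  by rewrite a2; field; rewrite gt_eqF.
have key : ln (3 / delta) + 2 * logM <= 3 / 4 * n%:R * e ^+ 2.
  have : 3 / 4 * (49 / 16 * (n%:R * a ^+ 2)) + 3 / 4 * n%:R * B ^+ 2 <=
      3 / 4 * n%:R * e ^+ 2.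
    rewrite eE (_ : 3 / 4 * n%:R * (7 / 4 * a + B) ^+ 2 =
       3 / 4 * (49 / 16 * (n%:R * a ^+ 2)) + 3 / 4 * n%:R * B ^+ 2 +
       21 / 8 * (n%:R * (a * B))); last by field.
    by rewrite lerDl !mulr_ge0 ?(ltW nR).
  rewrite na2; lra.
have M2 : M ^+ 2 <= expR (2 * logM).
  by rewrite expRM_natl lerXn2r ?nnegrE ?expR_ge0.
have E1 : expR (- (3 / 4 * n%:R * e ^+ 2)) <= delta / 3 * expR (- (2 * logM)).
  rewrite (_ : delta / 3 = expR (- ln (3 / delta))); last first.
    by rewrite expRN lnK ?posrE ?divr_gt0// invf_div.
  by rewrite -expRD ler_expR; lra.
apply: (@le_trans _ _
    (2 * expR (2 * logM) * (delta / 3 * expR (- (2 * logM))))).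
  by apply: ler_pM => //; rewrite ?mulr_ge0 ?sqr_ge0 ?expR_ge0// ler_wpM2l.
rewrite (_ : 2 * expR (2 * logM) * (delta / 3 * expR (- (2 * logM))) =
  2 / 3 * delta * (expR (2 * logM) * expR (- (2 * logM)))); last by field.
by rewrite expRxMexpNx_1 mulr1.
Qed.

Theorem theorem2p6 (R : realType) (n d k : nat) (L delta : R)
    (n_gt0 : (0 < n)%N) (d_gt0 : (0 < d)%N) (k_gt0 : (0 < k)%N)
    (L_ge2 : 2 <= L) (delta_gt0 : 0 < delta) (delta_le1 : delta <= 1) :
  exists (b : nat)
    (V : n.-tuple (d.-tuple (measurableTypeR R)) ->
         d.-tuple (measurableTypeR R) -> R),
    [/\ (0 < b)%N, estimator b k V &
      (ereal_sup
         [set sample_law p n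
            [set s | (((21 * d%:R * k%:R `^ 3^-1 * L `^ ((d%:R + 3) / 12)
                         / n%:R `^ 3^-1)
                       * Num.sqrt (ln (3 * L * d%:R * k%:R * n%:R))
                       + 7 * Num.sqrt (ln (3 / delta) / (2 * n%:R)))%R%:E
                      < L1norm (fun x => V s x - p x)%R)%E]
         | p in multiview d k (Lip L)]
       < delta%:E)%E].
Proof.
have L0 : 0 <= L by lra.
pose b := bins n k L; have b0 : (0 < b)%N by [].
pose K := (Num.truncn (b%:R * (1 + L))).+1.
pose I := net_index d k b (k * b) K.
pose f : I -> d.-tuple (measurableTypeR R) -> R := @net R d k b (k * b) K.
have pf i : pdf (@lebesgue_tuple R d) (f i) by exact: pdf_net.
have f_out i x : ~ cube d x -> f i x = 0 by exact: net_out.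
have i0 : I by exact: ([ffun=> ord0], [ffun=> [ffun=> ord0]]).
pose sel (s : n.-tuple (d.-tuple (measurableTypeR R))) : I :=
  mindist_selector (@lebesgue_tuple R d) i0 f s.
have msel i : measurable [set s | sel s = i].
  exact: measurable_mindist_selector.
exists b, (fun s => f (sel s)); split => //.
  split; first by move=> s; exact: Hist_net.
  by apply: measurable_select => // i; have [] := pf i.
set rate := _ * L `^ _ / _; set a := Num.sqrt (_ / _).
rewrite -/(logterm n d k L); set X := Num.sqrt _; pose r := rho n k L.
have X1 : 1 <= X by rewrite -sqrtr1 ler_wsqrtr// logterm_ge1.
have X2 : X ^+ 2 = logterm n d k L.
  by rewrite sqr_sqrtr// (le_trans _ (logterm_ge1 n_gt0 d_gt0 k_gt0 L_ge2)).
have r0 : 0 < r by exact: rho_gt0.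
have a0 : 0 <= a by exact: sqrtr_ge0.
have dR : 1 <= d%:R :> R by rewrite ler1n.
have rX : r <= d%:R * r * X.
  by rewrite mulrAC ler_peMl ?(ltW r0)// mulr_ege1.
have rateX : 21 * (d%:R * r * X) <= rate * X.
  rewrite !mulrA ler_wpM2r ?(le_trans _ X1)//.
  exact: (rho_le_rate n k d_gt0 L_ge2).
apply: (@le_lt_trans _ _ (2 / 3 * delta)%:E); last by rewrite lte_fin; lra.
apply: ub_ereal_sup => _ [p pQ <-].
have pp := pdf_on_cube L0 pQ.
have [P PE] := pdf_law pp.
rewrite /sample_law density_lawE -PE.
under eq_set => s do
  rewrite (L1norm_l1dist (pf (sel s)) pp (f_out (sel s))) lte_fin.
have [coarse|fine_scale] := leP 2 (21 * r).
  (* the threshold is at least 2, the largest L1 distance of two densities *)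
  rewrite (_ : [set s | _] = set0).
    by rewrite measure0 lee_fin; lra.
  apply/seteqP; split => // s /=; rewrite ltNge => /negP; apply.
  by apply: (le_trans (l1dist_le2 (pf _) pp)); lra.
have [j jE] := net_approx L_ge2 k_gt0 b0 pQ.
(* with three times the bias, at most 6 (d r X), the term 4 e adds up to
   21 (d r X) + 7 a *)
pose e := 7 / 4 * a + 15 / 4 * (d%:R * r * X).
have e0 : 0 < e by rewrite /e; lra.
have bias : 3 * d%:R * (L / b%:R) + 2 / b%:R <= 2 * (d%:R * r * X).
  have bR : 0 < b%:R :> R by rewrite ltr0n.
  have Lb : L / b%:R <= r / 2 by exact: bins_ratio.
  have tb : 2 / b%:R <= L / b%:R by rewrite ler_wpM2r ?invr_ge0 ?(ltW bR).
  have rd : r <= d%:R * r by rewrite ler_peMl ?(ltW r0).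
  have rdX : d%:R * r <= d%:R * r * X.
    by rewrite ler_peMr// mulr_ge0// ltW.
  have dLb : d%:R * (L / b%:R) <= d%:R * (r / 2) by rewrite ler_wpM2l.
  rewrite -mulrA; lra.
apply: (le_trans
  (mindist_selector_risk i0 pf (e := e) (j := j) n_gt0 pp PE e0 _)).
  by rewrite /e; lra.
rewrite lee_fin.
apply: (failure_bound (a := a) (B := 15 / 4 * (d%:R * r * X))
  n_gt0 delta_gt0 delta_le1) => //.
- by apply/andP; split => //; exact: net_card_le.
- by rewrite mulr_ge0//; lra.
have := net_entropy_le n_gt0 d_gt0 k_gt0 L_ge2 fine_scale.
rewrite -/r -/b -!X2 => h; move: (h); rewrite !exprMn; lra.
Qed.
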